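(* Let $\lambda_c=\sqrt{\sqrt{6}-2}$ and let $\lambda<\lambda_c$ be fixed. Suppose that $p(n)\le \lambda n^{-1/2}$. Then for $\Gamma\in\mathcal{G}(n,p)$, asymptotically almost surely every square-component of $\Gamma$ covers at most $O\left((\log n)^{2^{32}}\right)$ vertices.
   Context: $\Gamma\in\mathcal{G}(n,p)$ means that $\Gamma$ is an Erdős–Rényi random graph on vertex set $[n]=\{1,\dots,n\}$: each pair is an edge independently with probability $p=p(n)$. ''Asymptotically almost surely'' (a.a.s.) means with probability tending to $1$ as $n\to\infty$; here the statement means that there is a constant $C$ (not depending on $n$) such that a.a.s. every square-component covers at most $C(\log n)^{2^{32}}$ vertices. For a graph $\Gamma$, the square-graph $\square(\Gamma)$ is the graph whose vertices are the non-edges of $\Gamma$ (unordered pairs of distinct non-adjacent vertices), and in which two non-edges $ac$ and $bd$ are adjacent if and only if $ab,bc,cd,da$ are all edges of $\Gamma$ (so that $ac$, $bd$ together induce a $4$-cycle). A square-component of $\Gamma$ is a connected component $C$ of $\square(\Gamma)$. Its support is $\mathrm{supp}(C)=\bigcup_{vw\in C}\{v,w\}\subseteq V(\Gamma)$, and $C$ is said to cover the vertices in $\mathrm{supp}(C)$. *)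

(* Defs.v *)
From HB Require Import structures.
From mathcomp Require Import all_boot all_order all_algebra.
From mathcomp Require Import all_classical all_reals all_analysis.

Set Implicit Arguments.
Unset Strict Implicit.
Unset Printing Implicit Defensive.

Import Order.TTheory GRing.Theory Num.Theory.
Import numFieldNormedType.Exports.

Local Open Scope ring_scope.

(* A graph on T is represented by its edge set, a subset of [pairs T]. *)
Definition pairs (T : finType) : {set {set T}} :=
  [set e : {set T} | #|e| == 2%N].

Section SquareGraph.
Variables (T : finType) (E : {set {set T}}).

Definition adj : rel T := fun u v => [set u; v] \in E.

Definition nonedges : {set {set T}} := pairs T :\: E.

Definition square_adj : rel {set T} := fun f g =>
  [&& f \in nonedges, g \in nonedges &
    [exists a, exists c, exists b, exists d,
      [&& f == [set a; c], g == [set b; d],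
          adj a b, adj b c, adj c d & adj d a]]].

Definition square_components : {set {set {set T}}} :=
  equivalence_partition (connect square_adj) nonedges.

End SquareGraph.

Definition supp (T : finType) (C : {set {set T}}) : {set T} :=
  finset.cover C.

(* The probability that a random graph in G(n,p) satisfies A. *)
Definition gnp_prob (R : realType) (n : nat) (p : R)
    (A : pred {set {set 'I_n}}) : R :=
  \sum_(E in powerset (pairs 'I_n) | A E)
    \prod_(e in pairs 'I_n) (if e \in E then p else 1 - p).

(* Main.v *)
Require Import Defs.
From HB Require Import structures.
From mathcomp Require Import all_boot all_order all_algebra.
From mathcomp Require Import all_classical all_reals all_analysis.
From mathcomp Require Import zify ring lra.

Set Implicit Arguments.
Unset Strict Implicit.
Unset Printing Implicit Defensive.

Import Order.TTheory GRing.Theory Num.Theory.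
Import numFieldNormedType.Exports.

(* Explore the square-component of a nonedge pair by pair: to process {a,c}, add
   all common neighbours of a and c to the discovered set and put all pairs of
   common neighbours on the list.  Edges at undiscovered vertices are only known
   through non-adjacencies, so the number k of new vertices in a step has factorial
   moments at most those of a Poisson variable with mean lambda^2.  A typical pair has
   two old common neighbours, forming a known pair, so it generates C(k+2,2) - 1
   new pairs, on average lambda^4/2 + 2 lambda^2, which is < 1 exactly when
   lambda < lambda_c.

   Three bad events are excluded, the first two with probability o(n^-2) per start:
   - more than four extra edges among the discovered vertices; each costs a factor
     n^(-1/2) up to logarithms, and five of them beat the n^2 starting pairs;
   - the exploration surviving for t = O(log^3 n) steps, by an exponential
     moment, all codegrees being bounded by L = O(log n);
   - some pair having more than L common neighbours, by a first moment.
   With at most four extra edges, only 224 processed pairs can have more than two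
   old common neighbours, so the exploration stops within t steps and
   the component is covered by 2 + t L = O(log^4 n) vertices. *)

(** * Exploration of a square-component *)

Section Exploration.
Variables (T : finType) (L : nat).
Implicit Types (E F : {set {set T}}) (f g e : {set T}).

Lemma pairsP e : reflect (exists x y, x != y /\ e = [set x; y]) (e \in pairs T).
Proof.
rewrite inE; apply: (iffP idP) => [/cards2P[x [y [xy ->]]]|[x [y [xy ->]]]].
  by exists x, y.
by rewrite cards2 xy.
Qed.

Lemma subset_pair_eq f g : f \in pairs T -> f \subset g -> (#|g| <= 2)%N -> g = f.
Proof.
rewrite inE => /eqP f2 fg g2; apply/esym/eqP.
by rewrite eqEcard fg f2.
Qed.

Definition common_nbrs E f : {set T} := [set x | [forall a in f, [set a; x] \in E]].

Definition cross (f S : {set T}) : {set {set T}} :=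
  [set [set a; x] | a in f, x in S].

(** The pairs first exposed when [N] joins the discovered set [V]. Those from [f] to [N] are left
    out because they are edges by the choice of [N]; an edge among the rest is a coincidence. *)
Definition frontier (V f N : {set T}) : {set {set T}} :=
  [set e in pairs T | [&& e \subset V :|: N, ~~ [disjoint e & N] & e \notin cross f N]].

(* [gen] is the set of pairs reached so far and [expl] those already processed.
   A vertex discovered while processing [f] has parent pair [par x = f], and all
   its other edges back to the discovered set go to [extra].  [score] bounds the
   number of pairs a step would generate if the processed pair had at most two
   old common neighbours.  [ok] records that no step met a pair with more than
   [L] common neighbours.  Generated pairs are not required to be nonedges, which
   only enlarges the exploration. *)
Record state := State {
  disc : {set T};
  expl : {set {set T}};
  gen : {set {set T}};
  par : T -> {set T};
  rnk : T -> nat;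
  extra : {set {set T}};
  score : nat;
  ok : bool }.

Definition next s : option {set T} := [pick f in gen s :\: expl s].

(** New vertices get a rank above all earlier ones, which later excludes cycles of parents. The
    increment of [score] is C(k+2,2) - C(2,2) for k new vertices. *)
Definition step_at E s f :=
  let C := common_nbrs E f in
  let N := C :\: disc s in
  State (disc s :|: C) (f |: expl s) (gen s :|: [set g in pairs T | g \subset C])
    (fun x => if x \in N then f else par s x)
    (fun x => if x \in N then #|expl s|.+1 else rnk s x)
    (extra s :|: (E :&: frontier (disc s) f N))
    (score s + ('C(#|N|, 2) + 2 * #|N|))
    (ok s && (#|C| <= L)%N).

Definition step E s := if next s is Some f then step_at E s f else s.

Definition init f0 := State f0 finset.set0 [set f0] (fun=> finset.set0) (fun=> 0%N) finset.set0 0 true.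

Definition run E f0 t := iter t (step E) (init f0).

Lemma nextP s f : next s = Some f -> f \in gen s /\ f \notin expl s.
Proof. by rewrite /next; case: pickP => // g; rewrite inE => /andP[? ?] [<-]. Qed.

Lemma next_none s : next s = None -> gen s \subset expl s.
Proof.
rewrite /next; case: pickP => // H _; apply/fintype.subsetP => f fg.
by apply/negPn/negP => fX; have := H f; rewrite inE fg fX.
Qed.

Lemma in_common_nbrs E f x : (x \in common_nbrs E f) = [forall a in f, [set a; x] \in E].
Proof. by rewrite inE. Qed.

Lemma common_nbrs_subset E E' f : E \subset E' -> common_nbrs E f \subset common_nbrs E' f.
Proof.
move=> EE; apply/fintype.subsetP => x; rewrite !inE => /forall_inP H.
by apply/forall_inP => a /H; apply: (fintype.subsetP EE).
Qed.

Lemma in_pair_frontier u v V f N : u != v -> u \in V :|: N -> v \in N ->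
  [set u; v] \notin cross f N -> [set u; v] \in frontier V f N.
Proof.
move=> uv uVN vN H; rewrite !inE cards2 uv eqxx H andbT /=; apply/andP; split.
  by apply/fintype.subsetP => z; rewrite !inE => /orP[] /eqP ->;
     [move: uVN; rewrite inE | rewrite vN orbT].
by apply/pred0Pn; exists v; rewrite /= !inE eqxx orbT vN.
Qed.

(** * Locality and size of a run *)

Section Run.
Variables (f0 : {set T}) (f0_pair : f0 \in pairs T).

Lemma run_gen E t f : f \in gen (run E f0 t) ->
  f \in pairs T /\ f \subset disc (run E f0 t).
Proof.
elim: t f => [|t IH] f /=; first by rewrite inE => /eqP ->.
rewrite /step; case Hn: next => [g|] //=; last exact: IH.
rewrite inE => /orP[/IH [? fV]|]; first by split=> //; apply: fintype.subset_trans fV (finset.subsetUl _ _).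
rewrite inE => /andP[? fC]; split=> //; apply: fintype.subset_trans fC (finset.subsetUr _ _).
Qed.

Lemma disc_step E s : disc s \subset disc (step E s).
Proof. by rewrite /step; case: next => //= f; apply: finset.subsetUl. Qed.

(* Deleting an edge at an undiscovered vertex is invisible to the exploration. *)
Lemma run_del E t e x : x \in e -> x \notin disc (run E f0 t) ->
  run (E :\ e) f0 t = run E f0 t.
Proof.
move=> xe; elim: t => [|t IH] //= xV.
have xV' : x \notin disc (run E f0 t).
  by apply: contra xV; apply: (fintype.subsetP (disc_step _ _)).
rewrite -!/(run _ _ _) IH //; move: xV; rewrite -/(run E f0 t).
set s := run E f0 t in xV' *.
rewrite /step; case Hn: next => [f|] //= xV.
have [fg _] := nextP Hn; have [_ fV] := run_gen fg.
(* An edge from [f] to a common neighbour has both ends discovered after this step, while [e]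
   contains the undiscovered [x]. *)
have CE : common_nbrs (E :\ e) f = common_nbrs E f.
  apply/eqP; rewrite finset.eqEsubset common_nbrs_subset ?finset.subsetDl //=.
  apply/fintype.subsetP => y yC; rewrite in_common_nbrs; apply/forall_inP => a af.
  move: (yC); rewrite in_common_nbrs => /forall_inP/(_ a af) H; rewrite !inE H andbT.
  apply: contraNneq xV => eE; move: xe; rewrite -eE in_set2 => /orP[] /eqP -> /=.
    by rewrite finset.in_setU (fintype.subsetP fV _ af).
  by rewrite finset.in_setU yC orbT.
rewrite /step_at CE; do 2 f_equal.
apply/finset.setP => g; rewrite !finset.in_setI finset.in_setD1.
case: (eqVneq g e) => //= -> ; apply/esym/negbTE; apply/negP => /andP[_].
rewrite inE => /andP[_ /and3P[/fintype.subsetP/(_ x xe) + _ _]].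
by move: xV => /=; rewrite !finset.in_setU finset.in_setD; case: (x \in disc s) => /= /negP.
Qed.

(** Common neighbours are witnessed by pairs from [f] to old vertices, which miss the new set, and
    by pairs in [cross]; the frontier contains neither kind. *)
Lemma common_nbrs_del E (V : {set T}) f e : f \subset V ->
  e \in frontier V f (common_nbrs E f :\: V) ->
  common_nbrs (E :\ e) f = common_nbrs E f.
Proof.
move=> fV; rewrite inE => /andP[_ /and3P[eVN eN ecr]].
apply/eqP; rewrite finset.eqEsubset common_nbrs_subset ?finset.subsetDl //=.
apply/fintype.subsetP => y yC; rewrite in_common_nbrs; apply/forall_inP => a af.
move: (yC); rewrite in_common_nbrs => /forall_inP/(_ a af) H; rewrite !inE H andbT.
apply: contraNneq ecr => eE; rewrite -eE; apply/imset2P; exists a y => //.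
rewrite inE yC andbT; apply: contraNN eN => yV.
rewrite -eE -finset.setI_eq0; apply/eqP/finset.setP => z; rewrite !inE.
by case: eqP => [->|_]; [rewrite (fintype.subsetP fV _ af)|case: eqP => [->|//]; rewrite yV].
Qed.

Lemma ok_step E s : ok (step E s) -> ok s.
Proof. by rewrite /step; case: next => //= f /andP[]. Qed.

Lemma card_disc_run E t : ok (run E f0 t) -> (#|disc (run E f0 t)| <= 2 + t * L)%N.
Proof.
elim: t => [|t IH] /=; first by move: f0_pair; rewrite inE => /eqP ->.
rewrite -!/(run E f0 t) => /[dup] /ok_step /IH {}IH.
rewrite /step; case: next => [f|] /= => [/andP[_ CL]|_].
  by rewrite (leq_trans (leq_card_setU _ _)) // mulSn addnCA addnC leq_add.
by rewrite (leq_trans IH) // leq_add2l leq_mul2r leqnSn orbT.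
Qed.

Lemma ok_run E t : (forall f, f \in pairs T -> #|common_nbrs E f| <= L)%N ->
  ok (run E f0 t).
Proof.
move=> H; elim: t => [|t IH] //=; rewrite -/(run E f0 t) /step.
case Hn: next => [f|] //=; rewrite IH H //.
by have [fg _] := nextP Hn; have [] := run_gen fg.
Qed.

End Run.

(* The unexplored pairs that may have three or more old common neighbours; there
   are boundedly many of them as long as there are boundedly many extra edges. *)
Definition bad s : {set {set T}} :=
  \bigcup_(a in finset.cover (extra s))
    [set [set a; c] | c in finset.cover (extra s) :|:
       \bigcup_(y in par s a :|: finset.cover (extra s)) par s y].

Lemma card_bigcup_leq (I J : finType) (A : {set I}) (F : I -> {set J}) k :
  (forall i, i \in A -> #|F i| <= k)%N -> (#|\bigcup_(i in A) F i| <= #|A| * k)%N.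
Proof.
move=> H; rewrite -sum_nat_const.
apply: (@leq_trans (\sum_(i in A) #|F i|)%N); last exact: leq_sum.
elim/big_rec2: _ => [|i m B iA IH]; first by rewrite cards0.
by rewrite (leq_trans (leq_card_setU _ _)) // leq_add2l.
Qed.

(** Four extra edges have at most 8 endpoints a. Each a admits at most 8 + (2 + 8) * 2 = 28 partners
    c: the 8 endpoints, and the parents of at most 2 + 8 vertices y. In total 8 * 28 = 224. *)
Lemma card_bad s : (forall x, #|par s x| <= 2)%N -> (forall e, e \in extra s -> #|e| <= 2)%N ->
  (#|extra s| <= 4 -> #|bad s| <= 224)%N.
Proof.
move=> par2 e2 x4.
have X8 : (#|finset.cover (extra s)| <= 8)%N.
  by apply: leq_trans (card_bigcup_leq e2) _; rewrite (leq_mul2r 2 _ 4) x4.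
apply: leq_trans (_ : 8 * 28 <= _)%N => //.
apply: leq_trans (card_bigcup_leq (k := 28) _) _; last by rewrite leq_mul2r X8.
move=> a _; apply: leq_trans (leq_imset_card _ _) _.
apply: leq_trans (leq_card_setU _ _) _.
apply: (@leq_trans (8 + 10 * 2)%N) => //; apply: leq_add => //.
apply: leq_trans (card_bigcup_leq (k := 2) _) _ => // ; rewrite leq_mul2r /=.
by apply: leq_trans (leq_card_setU _ _) _; apply: (@leq_add _ _ 2 8).
Qed.

(** * Invariants of the exploration and containment of the component *)

Section Invariants.
Variables (E : {set {set T}}) (f0 : {set T}).
Hypotheses (E_pairs : E \subset pairs T) (f0_nonedge : f0 \in nonedges E).

Lemma f0_pair : f0 \in pairs T.
Proof. by move: f0_nonedge; rewrite inE => /andP[]. Qed.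

(** By [inv_edge] the discovered graph consists of edges to parent pairs and of extra edges, and
    ranks orient the former. [inv_count] charges each processed pair to the score, with an
    additional allowance [L ^ 2] if it is bad. *)
Record invariant s : Prop := Invariant {
  inv_gen : forall f, f \in gen s -> f \in pairs T /\ f \subset disc s;
  inv_expl : expl s \subset gen s;
  inv_rnk : forall x, x \in disc s -> (rnk s x <= #|expl s|)%N;
  inv_par_rnk : forall x y, y \in par s x -> (rnk s y < rnk s x)%N;
  inv_par_expl : forall x, par s x = finset.set0 \/ par s x \in expl s;
  inv_par_out : forall x, x \notin disc s -> par s x = finset.set0;
  inv_edge : forall u v, u \in disc s -> v \in disc s -> [set u; v] \in E ->
    [\/ [set u; v] \in extra s, v \in par s u | u \in par s v];
  inv_parent : forall f, f \in gen s ->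
    f = f0 \/ exists2 g, g \in expl s & f \subset common_nbrs E g;
  inv_start : f0 \notin expl s -> s = init f0;
  inv_closed : forall f g, f \in expl s -> g \in pairs T -> g \subset common_nbrs E f ->
    g \in gen s;
  inv_nbrs : forall f, f \in expl s -> common_nbrs E f \subset disc s;
  inv_extra : extra s \subset pairs T;
  inv_count : ok s -> (#|gen s| <= 1 + score s + L ^ 2 * #|expl s :&: bad s|)%N }.

Lemma invariant_init : invariant (init f0).
Proof.
split => //=.
- by move=> f; rewrite inE => /eqP ->; rewrite f0_pair.
- by rewrite finset.sub0set.
- by move=> x y; rewrite inE.
- by left.
(* An edge inside [f0] would be [f0] itself, which is a nonedge. *)
- move: f0_nonedge; rewrite inE => /andP[f0E]; rewrite inE => /eqP f02.
  move=> u v uf vf uvE.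
  have uv : #|[set u; v]| = 2%N.
    by have /(fintype.subsetP E_pairs) := uvE; rewrite inE => /eqP.
  suff f0uv : [set u; v] = f0 by rewrite f0uv (negbTE f0E) in uvE.
  apply/eqP; rewrite eqEcard uv f02 leqnn andbT.
  by apply/fintype.subsetP => z; rewrite !inE => /orP[] /eqP ->.
- by move=> f; rewrite inE => /eqP ->; left.
- by move=> f g; rewrite inE.
- by move=> f; rewrite inE.
- by rewrite finset.sub0set.
- by rewrite cards1.
Qed.

Lemma common_nbrs_sym f g : f \subset common_nbrs E g -> g \subset common_nbrs E f.
Proof.
move=> fg; apply/fintype.subsetP => x xg; rewrite inE; apply/forall_inP => a af.
by have := fintype.subsetP fg _ af; rewrite inE finset.setUC => /forall_inP/(_ _ xg).
Qed.

Lemma inv_par_card s : invariant s -> forall x, (#|par s x| <= 2)%N.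
Proof.
move=> Hs x; case: (inv_par_expl Hs x) => [->|]; first by rewrite cards0.
by move/(fintype.subsetP (inv_expl Hs))/(inv_gen Hs) => []; rewrite inE => /eqP ->.
Qed.

(* If no extra edge met [f], all old common neighbours of [f] would lie in the
   parent pair of the endpoint discovered last. *)
Lemma many_old_nbrs_bad s f : invariant s -> f \in gen s -> f \notin expl s ->
  (2 < #|common_nbrs E f :&: disc s|)%N -> f \in bad s.
Proof.
move=> Hs fg fX.
have [/pairsP [a [c [ac fE]]] fV] := inv_gen Hs fg.
set O := _ :&: _ => lt_O2.
set X := finset.cover (extra s).
have aV : a \in disc s by apply: (fintype.subsetP fV); rewrite fE !inE eqxx.
have cV : c \in disc s by apply: (fintype.subsetP fV); rewrite fE !inE eqxx orbT.
have inX u v : [set u; v] \in extra s -> u \in X /\ v \in X.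
  by move=> H; split; apply/finset.bigcupP; exists [set u; v] => //; rewrite !inE eqxx ?orbT.
have Oa y : y \in O -> [\/ [set a; y] \in extra s, y \in par s a | a \in par s y].
  rewrite finset.in_setI inE => /andP[/forall_inP yC yV].
  by apply: inv_edge => //; apply: yC; rewrite fE !inE eqxx.
have Oc y : y \in O -> [\/ [set c; y] \in extra s, y \in par s c | c \in par s y].
  rewrite finset.in_setI inE => /andP[/forall_inP yC yV].
  by apply: inv_edge => //; apply: yC; rewrite fE !inE eqxx orbT.
(* A parent pair containing both ends is [f] itself, but parent pairs have been processed and [f]
   has not. *)
have noboth y : a \in par s y -> c \in par s y -> False.
  move=> ay cy; have := inv_par_expl Hs y; case=> [y0|yX]; first by rewrite y0 inE in ay.
  suff fy : par s y = f by rewrite fy (negbTE fX) in yX.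
  apply: subset_pair_eq => //; first by case: (inv_gen Hs fg).
    by apply/fintype.subsetP => z; rewrite fE !inE => /orP[] /eqP ->.
  exact: inv_par_card.
have notsub x : ~ (O \subset par s x).
  by move/subset_leq_card => H; have := inv_par_card Hs x; rewrite leqNgt (leq_trans lt_O2 H).
have {}notsub x : exists2 y, y \in O & y \notin par s x.
  by have /negP/subsetPn := notsub x.
(* If [u] meets an extra edge and [v] does not, some y in [O] outside the parents of [v] has [v] as
   a parent. Then [u] is not a parent of y too, so y lies in [par s u] or on an extra edge, as [bad]
   requires. *)
have key u v : u \in X -> (f = [set u; v]) ->
  (forall y, y \in O -> [\/ [set u; y] \in extra s, y \in par s u | u \in par s y]) ->
  (forall y, y \in O -> [\/ [set v; y] \in extra s, y \in par s v | v \in par s y]) ->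
  (forall y, u \in par s y -> v \in par s y -> False) -> f \in bad s.
  move=> uX fuv Ou Ov nb; apply/finset.bigcupP; exists u => //.
  rewrite fuv; apply/imsetP; exists v => //; rewrite finset.in_setU -/X.
  have [//|vX] := boolP (v \in X); rewrite orFb.
  have [y yO yv] := notsub v.
  have vy : v \in par s y.
    by case: (Ov _ yO) => // [/inX[]|yv']; [rewrite (negbTE vX)|rewrite yv' in yv].
  apply/finset.bigcupP; exists y => //; rewrite finset.in_setU.
  case: (Ou _ yO) => [/inX[_ ->]|->|uy]; rewrite ?orbT //.
  by case: (nb y).
have [aX|aX] := boolP (a \in X); first exact: (key a c).
have [cX|cX] := boolP (c \in X).
  by apply: (key c a) => // [|y cy ay]; [rewrite finset.setUC|apply: (noboth y)].
have Oa' y : y \in O -> y \notin par s a -> a \in par s y.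
  by move=> yO ya; case: (Oa _ yO) => // [/inX[]|ya']; [rewrite (negbTE aX)|rewrite ya' in ya].
have Oc' y : y \in O -> y \notin par s c -> c \in par s y.
  by move=> yO yc; case: (Oc _ yO) => // [/inX[]|yc']; [rewrite (negbTE cX)|rewrite yc' in yc].
(* With no extra edge at [a] or [c], ranks would increase strictly along the parent-to-child steps
   a, y, c, z, a, which is absurd. *)
have [y yO ya] := notsub a; have [z zO zc] := notsub c.
have ay := Oa' _ yO ya; have cz := Oc' _ zO zc.
have yc : y \in par s c by apply/negPn/negP => yc; apply: (noboth y) => //; apply: Oc'.
have za : z \in par s a by apply/negPn/negP => za; apply: (noboth z) => //; apply: Oa'.
have := ltn_trans (ltn_trans (inv_par_rnk Hs ay) (inv_par_rnk Hs yc))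
  (ltn_trans (inv_par_rnk Hs cz) (inv_par_rnk Hs za)).
by rewrite ltnn.
Qed.

Lemma bad_mono s s' : extra s \subset extra s' -> (forall x, par s x \subset par s' x) ->
  bad s \subset bad s'.
Proof.
move=> xx pp; have cov : finset.cover (extra s) \subset finset.cover (extra s').
  by apply/bigcupsP => e /(fintype.subsetP xx) ex; apply: finset.bigcup_sup.
apply/bigcupsP => a aX; apply: fintype.subset_trans (finset.bigcup_sup a _); last first.
  exact: (fintype.subsetP cov).
apply: imsetS; apply: finset.setUSS => //; apply/bigcupsP => y yX.
apply: fintype.subset_trans (pp y) _; apply: finset.bigcup_sup.
by move: y yX; apply/fintype.subsetP; apply: finset.setUSS.
Qed.

Lemma invariant_step s : invariant s -> invariant (step E s).
Proof.
move=> Hs; rewrite /step; case Hn: next => [f|] //.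
have [fg fX] := nextP Hn; have [fP fV] := inv_gen Hs fg.
set C := common_nbrs E f; set N := C :\: disc s.
have NV x : x \in N -> x \notin disc s by rewrite finset.in_setD => /andP[].
have parN x : x \in N -> par s x = finset.set0 by move/NV; apply: inv_par_out.
have VN x : x \in disc s -> (x \in N) = false by rewrite finset.in_setD => ->.
have card_expl : #|f |: expl s| = #|expl s|.+1 by rewrite cardsU1 fX.
have par_sub x : par s x \subset par (step_at E s f) x.
  by rewrite /=; case: ifP => // /parN ->; rewrite finset.sub0set.
split; rewrite /= -/C -/N.
- move=> g; rewrite finset.in_setU => /orP[/(inv_gen Hs)[gP gV]|].
    by split => //; apply: fintype.subset_trans gV (finset.subsetUl _ _).
  rewrite inE => /andP[gP gC]; split => //.
  exact: fintype.subset_trans gC (finset.subsetUr _ _).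
- apply/fintype.subsetP => g; rewrite finset.in_setU1 finset.in_setU => /orP[/eqP ->|gX].
    by rewrite fg.
  by rewrite (fintype.subsetP (inv_expl Hs)).
- move=> x; rewrite card_expl finset.in_setU; case: ifP => // xN /orP[xV|xC].
    exact/leqW/(inv_rnk Hs).
  have xV : x \in disc s by apply/negPn/negP => xV; rewrite finset.in_setD xV xC in xN.
  exact/leqW/(inv_rnk Hs).
- move=> x y; case: ifP => xN.
    move=> yf; have yV := fintype.subsetP fV _ yf.
    by rewrite VN // ltnS (inv_rnk Hs).
  case: ifP => yN; last exact: inv_par_rnk.
  move=> yx; exfalso; case: (inv_par_expl Hs x) => [x0|/(fintype.subsetP (inv_expl Hs))].
    by rewrite x0 inE in yx.
  move/(inv_gen Hs) => [_ /fintype.subsetP/(_ _ yx)].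
  by rewrite (negbTE (NV _ yN)).
- move=> x; case: ifP => _; first by right; rewrite finset.setU11.
  by case: (inv_par_expl Hs x) => H; [left|right; rewrite finset.in_setU1 H orbT].
- move=> x; rewrite finset.in_setU negb_or => /andP[xV xC].
  by rewrite finset.in_setD (negbTE xC) andbF inv_par_out.
- have edgeN u v : u \in disc s :|: N -> v \in N -> [set u; v] \in E ->
      [\/ [set u; v] \in extra (step_at E s f), v \in par (step_at E s f) u | u \in par (step_at E s f) v].
    move=> uVN vN uvE; rewrite /= -/C -/N vN.
    (* A pair in [cross f N] joins a new vertex to its parent; any other edge at a new vertex is on
       the frontier and becomes extra. *)
    have [/imset2P[a x af xN auv]|cr] := boolP ([set u; v] \in cross f N).
      constructor 3; have av : a != v.
        by apply: contraTneq vN => <-; rewrite VN ?(fintype.subsetP fV).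
      have : a \in [set u; v] by rewrite auv !inE eqxx.
      by rewrite in_set2 (negbTE av) orbF => /eqP <-.
    constructor 1; rewrite finset.in_setU finset.in_setI uvE in_pair_frontier ?orbT //.
    have /(fintype.subsetP E_pairs) := uvE.
    by rewrite inE cards2; case: (u != v).
  have VCN : disc s :|: C = disc s :|: N.
    by apply/finset.setP => x; rewrite !finset.in_setU finset.in_setD; case: (x \in disc s).
  move=> u v; rewrite VCN => uVN vVN uvE.
  have [vN|vN] := boolP (v \in N); first by have := edgeN _ _ uVN vN uvE; rewrite /= -/C -/N vN.
  have [uN|uN] := boolP (u \in N).
    have := edgeN v u vVN uN; rewrite finset.setUC => /(_ uvE) /=; rewrite -/C -/N (negbTE vN) uN.
    by case; [constructor 1|constructor 3|constructor 2].
  move: uVN vVN; rewrite !finset.in_setU (negbTE uN) (negbTE vN) !orbF => uV vV.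
  by case: (inv_edge Hs uV vV uvE) => H; [constructor 1; rewrite H|constructor 2|constructor 3].
- move=> g; rewrite finset.in_setU => /orP[/(inv_parent Hs)[->|[h hX gh]]|].
  + by left.
  + by right; exists h => //; rewrite finset.in_setU1 hX orbT.
  + by rewrite inE => /andP[_ gC]; right; exists f => //; rewrite finset.setU11.
- rewrite finset.in_setU1 negb_or => /andP[f0f f0X]; exfalso.
  move: f0f fg; rewrite (inv_start Hs f0X) /= finset.in_set1 eq_sym.
  by case: eqP.
- move=> h g; rewrite finset.in_setU1 finset.in_setU => /orP[/eqP -> gP gC|hX gP gC].
    by rewrite [g \in finset _]inE gP gC orbT.
  by rewrite (inv_closed Hs hX gP gC).
- move=> h; rewrite finset.in_setU1 => /orP[/eqP ->|hX]; first exact: finset.subsetUr.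
  exact: fintype.subset_trans (inv_nbrs Hs hX) (finset.subsetUl _ _).
- rewrite finset.subUset (inv_extra Hs) /=.
  by apply: fintype.subset_trans (finset.subsetIl _ _) E_pairs.
- case/andP => oks CL; have IH := inv_count Hs oks.
  have bad_sub : bad s \subset bad (step_at E s f).
    by apply: bad_mono => //=; apply: finset.subsetUl.
  set O := C :&: disc s.
  set PC := [set g in pairs T | g \subset C].
  have card_PC (A : {set T}) : #|[set g in pairs T | g \subset A]| = 'C(#|A|, 2).
    rewrite -cards_draws; apply: eq_card => g; rewrite !inE andbC //.
  have CON : #|C| = (#|O| + #|N|)%N by rewrite (cardsID (disc s) C).
  rewrite -/(step_at E s f).
  (* With three or more old common neighbours [f] is bad and newly processed, so one more allowance
     [L ^ 2] pays for all pairs inside [C]. *)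
  have [le_O2|lt_O2] := leqP #|O| 2; last first.
    have fbad : f \in bad s by apply: many_old_nbrs_bad.
    have le1 : (#|expl s :&: bad s|.+1 <= #|(f |: expl s) :&: bad (step_at E s f)|)%N.
      rewrite -add1n; have <- : #|f |: (expl s :&: bad s)| = (1 + #|expl s :&: bad s|)%N.
        by rewrite cardsU1 finset.in_setI (negbTE fX).
      apply: subset_leq_card; rewrite finset.subUset finset.sub1set finset.in_setI finset.setU11 /=.
      rewrite (fintype.subsetP bad_sub _ fbad) /=.
      by apply: finset.setISS => //; apply: finset.subsetUr.
    have le2 : ('C(#|C|, 2) <= L ^ 2)%N.
      rewrite bin2; apply: (@leq_trans (#|C| * #|C|.-1)%N); first by rewrite leq_half_double -addnn -addnS leq_addr.
      by rewrite -mulnn leq_mul // (leq_trans (leq_pred _)).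
    apply: leq_trans (leq_card_setU _ _) _; rewrite card_PC.
    apply: leq_trans (leq_add IH le2) _.
    have arith l a b c y : (l + a <= b -> 1 + c + a + l <= 1 + (c + y) + b)%N.
      by clear; lia.
    by apply: arith; rewrite -mulnS leq_mul.
  (* A pair of old common neighbours is never new: if [f] was generated by [h], then [h] lies in [O]
     and exhausts it because [O] has at most two elements. For [f0] the set [O] is empty, as there
     are no loops. *)
  have pairO g : g \in pairs T -> g \subset O -> g \in gen s.
    move=> gP gO; have OE := subset_pair_eq gP gO le_O2.
    case: (inv_parent Hs fg) => [ff0|[h hX fh]].
      exfalso; have s0 : s = init f0 by apply: (inv_start Hs); rewrite -ff0.
      have /pairsP[x [y [_ gxy]]] := gP.
      have : x \in O by apply: (fintype.subsetP gO); rewrite gxy !inE eqxx.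
      rewrite /O s0 finset.in_setI /= => /andP[+ xf0].
      rewrite inE ff0 => /forall_inP/(_ _ xf0)/(fintype.subsetP E_pairs).
      by rewrite inE cards2 eqxx.
    have hg := fintype.subsetP (inv_expl Hs) _ hX.
    have [hP hV] := inv_gen Hs hg.
    have hO : h \subset O by rewrite finset.subsetI common_nbrs_sym.
    by rewrite -OE (subset_pair_eq hP hO le_O2).
  set PO := [set g in pairs T | g \subset O].
  have disj : (#|(gen s :|: PC) :\: gen s| + 'C(#|O|, 2) <= 'C(#|O| + #|N|, 2))%N.
    rewrite -CON -!card_PC -/PO -/PC.
    have -> : (#|(gen s :|: PC) :\: gen s| + #|PO|)%N = #|((gen s :|: PC) :\: gen s) :|: PO|.
      rewrite cardsU; suff -> : ((gen s :|: PC) :\: gen s) :&: PO = finset.set0 by rewrite cards0 subn0.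
      apply/finset.setP => g; rewrite finset.in_setI finset.in_setD [RHS]inE.
      apply/negbTE/negP => /andP[/andP[gs _]]; rewrite inE => /andP[gP gO].
      by rewrite pairO in gs.
    apply: subset_leq_card; rewrite finset.subUset; apply/andP; split.
      by apply/fintype.subsetP => g; rewrite finset.in_setD finset.in_setU; case: (g \in gen s).
    apply/fintype.subsetP => g; rewrite !inE => /andP[-> gO].
    exact: fintype.subset_trans gO (finset.subsetIl _ _).
  (* C(o+k,2) = C(o,2) + C(k,2) + o k, and here o is at most 2. *)
  have bino : ('C(#|O| + #|N|, 2) <= 'C(#|O|, 2) + ('C(#|N|, 2) + 2 * #|N|))%N.
    case: #|O| le_O2 => [|[|[|//]]] _; rewrite ?add0n ?add1n ?add2n.
    + by rewrite leq_addr.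
    + rewrite binS bin1; lia.
    + rewrite binS bin1 binS bin1; lia.
  have le1 : (#|expl s :&: bad s| <= #|(f |: expl s) :&: bad (step_at E s f)|)%N.
    by apply: subset_leq_card; apply: finset.setISS => //; apply: finset.subsetUr.
  have -> : #|gen s :|: PC| = (#|gen s| + #|(gen s :|: PC) :\: gen s|)%N.
    by rewrite -(cardsID (gen s) (gen s :|: PC)) finset.setUK.
  have arith (x d o k c y a b : nat) : (d + o <= k -> k <= o + y -> x <= 1 + c + a -> a <= b ->
      x + d <= 1 + (c + y) + b)%N by clear; lia.
  by apply: arith disj bino IH _; rewrite leq_mul.
Qed.

Lemma invariant_run t : invariant (run E f0 t).
Proof. by elim: t => [|t IH]; [apply: invariant_init|apply: invariant_step]. Qed.

Lemma card_expl_run t : next (run E f0 t) != None -> #|expl (run E f0 t)| = t.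
Proof.
elim: t => [|t IH] /=; first by rewrite cards0.
rewrite -/(run E f0 t) /step; case Hn: (next (run E f0 t)) => [f|]; last by rewrite Hn.
by move=> _ /=; rewrite cardsU1 (nextP Hn).2 IH // Hn.
Qed.

Lemma square_adj_common_nbrs f g : square_adj E f g ->
  g \in pairs T /\ g \subset common_nbrs E f.
Proof.
case/and3P=> _; rewrite inE => /andP[_ gP].
case/existsP=> a /existsP[c /existsP[b /existsP[d /and5P[/eqP -> /eqP gE ab bc /andP[cd da]]]]].
split => //; apply/fintype.subsetP => x; rewrite gE in_set2 => xbd.
rewrite inE; apply/forall_inP => y; rewrite in_set2 => yac.
by case/orP: xbd => /eqP ->; case/orP: yac => /eqP -> //; rewrite finset.setUC.
Qed.

(** A run that has not stopped has processed [t] distinct pairs, all of them generated, more than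
    [inv_count] and [card_bad] allow. After stopping, [gen] is closed under passing to pairs of
    common neighbours, hence under [square_adj]. *)
Lemma component_small t g : let s := run E f0 t in
  ok s -> (#|extra s| <= 4)%N -> (score s + 1 + 224 * L ^ 2 < t)%N ->
  connect (square_adj E) f0 g -> g \subset disc s.
Proof.
move=> s oks xs ts /connectP[p + ->] {g}.
have Hs : invariant s := invariant_run t.
have Hn : next s = None.
  apply/eqP/negPn/negP => /card_expl_run tE; rewrite -/s in tE.
  have := subset_leq_card (inv_expl Hs); rewrite tE leqNgt => /negP; apply.
  apply: leq_ltn_trans ts; apply: leq_trans (inv_count Hs oks) _.
  rewrite [(score s + 1)%N]addnC leq_add2l mulnC leq_mul2r.
  apply/orP; right; apply: leq_trans (subset_leq_card (finset.subsetIr _ _)) _.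
  apply: card_bad => // [|e]; first exact: inv_par_card.
  by move/(fintype.subsetP (inv_extra Hs)); rewrite inE => /eqP ->.
have sub := next_none Hn.
have gf0 : f0 \in gen s.
  have : f0 \in gen (run E f0 0) by rewrite inE.
  rewrite /s; elim: t {s oks xs ts Hs Hn sub} => [//|t IH] /IH /=; rewrite -/(run E f0 t) /step.
  by case: next => //= f; rewrite finset.in_setU => ->.
suff H q h : h \in gen s -> path (square_adj E) h q -> last h q \in gen s.
  by move/(H _ _ gf0)/(inv_gen Hs) => [].
elim: q h => [//|k q IH] h hs /= /andP[/square_adj_common_nbrs[kP kC]].
by apply: IH; apply: inv_closed kP kC => //; apply: (fintype.subsetP sub).
Qed.

Lemma supp_component_small t C : let s := run E f0 t in
  ok s -> (#|extra s| <= 4)%N -> (score s + 1 + 224 * L ^ 2 < t)%N ->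
  C \in square_components E -> f0 \in C -> (#|supp C| <= 2 + t * L)%N.
Proof.
move=> s oks xs ts /imsetP[h hn ->]; rewrite inE => /andP[_ hf0].
apply: leq_trans (card_disc_run f0_pair oks); apply: subset_leq_card.
apply/bigcupsP => g; rewrite inE => /andP[_ hg].
have sym : connect_sym (square_adj E).
  apply: sym_connect_sym => x y; rewrite /square_adj.
  have imp u v : square_adj E u v -> square_adj E v u.
    case/and3P=> un vn /existsP[a /existsP[c /existsP[b /existsP[d /and5P[ac bd ab bc /andP[cd da]]]]]].
    rewrite /square_adj un vn /=; apply/existsP; exists b; apply/existsP; exists d.
    apply/existsP; exists c; apply/existsP; exists a.
    by rewrite [[set c; a]]finset.setUC ac bd bc cd da ab.
  by apply/idP/idP; apply: imp.
by apply: (component_small oks xs ts); apply: connect_trans hg; rewrite sym.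
Qed.

End Invariants.
End Exploration.

Local Open Scope ring_scope.

(** * Random edge sets *)

Section RandomSet.
Variables (R : realType) (J : finType) (U : {set J}) (p : R).
Hypothesis p01 : 0 <= p <= 1.
Implicit Types (E Y : {set J}) (h : {set J} -> R).

Definition weight E : R := \prod_(e in U) (if e \in E then p else 1 - p).

Definition expect h : R := \sum_(E in powerset U) weight E * h E.

Lemma weight_ge0 E : 0 <= weight E.
Proof.
by apply: prodr_ge0 => e _; case: ifP; rewrite ?subr_ge0; case/andP: p01.
Qed.

Lemma expect_le h h' : (forall E, E \subset U -> h E <= h' E) -> expect h <= expect h'.
Proof.
move=> hh; apply: ler_sum => E; rewrite powersetE => EU.
by apply: ler_wpM2l; [apply: weight_ge0|apply: hh].
Qed.

Lemma eq_expect h h' : (forall E, E \subset U -> h E = h' E) -> expect h = expect h'.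
Proof. by move=> hh; apply: eq_bigr => E; rewrite powersetE => /hh ->. Qed.

Lemma expectZ c h : expect (fun E => c * h E) = c * expect h.
Proof. by rewrite /expect big_distrr /=; apply: eq_bigr => E _; rewrite mulrCA. Qed.

Lemma expectD h h' : expect (fun E => h E + h' E) = expect h + expect h'.
Proof. by rewrite /expect -big_split /=; apply: eq_bigr => E _; rewrite mulrDr. Qed.

Lemma expect_sum (K : finType) (P : pred K) (h : K -> {set J} -> R) :
  expect (fun E => \sum_(k | P k) h k E) = \sum_(k | P k) expect (h k).
Proof.
by rewrite /expect exchange_big /=; apply: eq_bigr => E _; rewrite big_distrr.
Qed.

Lemma expect1 : expect (fun=> 1) = 1.
Proof.
pose F e : R := if e \in U then p else 0; pose G e : R := if e \in U then 1 - p else 1.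
have FG1 : \prod_e (F e + G e) = 1.
  by apply: big1 => e _; rewrite /F /G; case: ifP => _; rewrite ?add0r // addrC subrK.
rewrite -[RHS]FG1 bigA_distr /expect [RHS](bigID (fun E : {set J} => E \subset U)) /= [X in _ = _ + X]big1 ?addr0.
  apply: eq_big => [E|E EU]; first by rewrite powersetE.
  rewrite /= mulr1 /weight [RHS](bigID (fun e => e \in U)) /= [X in _ = _ * X]big1 ?mulr1.
    by apply: eq_bigr => e eU; rewrite /F /G eU.
  move=> e eU; rewrite /F /G (negbTE eU); case: ifP => // eE.
  by move: EU; rewrite powersetE => /fintype.subsetP/(_ _ eE); rewrite (negbTE eU).
move=> E /subsetPn[e eE eU].
by rewrite (bigD1 e) //= eE /F (negbTE eU) mul0r.
Qed.

(** Pair each [E] containing [e] with [E :\ e]: the weights are in the ratio p to 1 - p, and [h] is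
    at least as large on the second set. *)
Lemma expect_mem_le e h : e \in U -> (forall E, 0 <= h E) ->
  (forall E, E \subset U -> e \in E -> h E <= h (E :\ e)) ->
  expect (fun E => (e \in E)%:R * h E) <= p * expect h.
Proof.
move=> eU h0 hdel; case/andP: p01 => p0 p1.
pose c E := \prod_(x in U :\ e) (if x \in E then p else 1 - p) : R.
have c0 E : 0 <= c E.
  by apply: prodr_ge0 => x _; case: ifP; rewrite ?subr_ge0.
have wE E : e \in E -> weight E = p * c E.
  by move=> eE; rewrite /weight (big_setD1 e) //= eE.
have wD E : weight (E :\ e) = (1 - p) * c E.
  rewrite /weight (big_setD1 e) //= finset.setD11; congr (_ * _).
  by apply: eq_bigr => x; rewrite !inE => /andP[-> _].
have -> : expect (fun E => (e \in E)%:R * h E) =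
          \sum_(E : {set J} | (E \subset U) && (e \in E)) p * c E * h E.
  rewrite /expect [RHS]big_mkcondr; apply: eq_big => [E|E _]; first by rewrite powersetE.
  by case: ifP => eE; rewrite /= ?mulr1n ?mulr0n ?mul1r ?mul0r ?mulr0 // wE.
have -> : expect h =
    \sum_(E : {set J} | (E \subset U) && (e \in E)) (p * c E * h E + (1 - p) * c E * h (E :\ e)).
  rewrite big_split /= /expect (bigID (fun E : {set J} => e \in E)) /=; congr (_ + _).
    by apply: eq_big => [E|E /andP[_ eE]]; rewrite ?powersetE // wE.
  rewrite (reindex_onto (fun E => E :\ e) (fun E => e |: E)) /=; last first.
    by move=> E /andP[_ eE]; rewrite finset.setU1K.
  apply: eq_big => [E|E _]; last by rewrite wD.
  rewrite powersetE finset.setD11 andbT; apply/andP/andP => [[EU /eqP <-]|[EU eE]].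
    by rewrite finset.setU11 finset.subUset finset.sub1set eU.
  by rewrite finset.setD1K // eqxx (fintype.subset_trans _ EU) // finset.subsetDl.
rewrite big_distrr /=; apply: ler_sum => E /andP[EU eE].
have := hdel _ EU eE; have := c0 E => cE hE.
have : 0 <= p * (1 - p) * c E * (h (E :\ e) - h E).
  by rewrite !mulr_ge0 // subr_ge0.
lra.
Qed.

(* Information that can only help when edges of [Y] are deleted does not raise the
   conditional probability that [Y] is present above [p ^+ #|Y|]. *)
Lemma expect_subset_le Y h : Y \subset U -> (forall E, 0 <= h E) ->
  (forall E e, E \subset U -> e \in Y -> e \in E -> h E <= h (E :\ e)) ->
  expect (fun E => (Y \subset E)%:R * h E) <= p ^+ #|Y| * expect h.
Proof.
move=> + h0; have [n] := ubnP #|Y|; elim: n Y => // n IH Y Yn YU hdel.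
have [->|[e eY]] := set_0Vmem Y.
  rewrite cards0 expr0 mul1r; apply: expect_le => E _.
  by rewrite finset.sub0set mul1r.
have cY := cardsD1 e Y; rewrite eY add1n in cY.
have YeU : Y :\ e \subset U by apply: fintype.subset_trans YU; apply: finset.subsetDl.
apply: (@le_trans _ _ (p * expect (fun E => (Y :\ e \subset E)%:R * h E))).
  apply: le_trans (expect_mem_le (e := e) _ _ _).
  - apply: expect_le => E EU; rewrite mulrA -natrM mulnb.
    by rewrite -{1}(finset.setD1K eY) finset.subUset finset.sub1set.
  - exact: (fintype.subsetP YU).
  - by move=> E; rewrite mulr_ge0.
  - move=> E EU eE; have -> : (Y :\ e \subset E :\ e) = (Y :\ e \subset E).
      apply/idP/idP => H; first exact: fintype.subset_trans H (finset.subsetDl _ _).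
      by rewrite finset.subsetD H disjoint_sym disjoints1 finset.setD11.
    by rewrite ler_wpM2l ?hdel.
rewrite cY exprS -mulrA ler_wpM2l //; first by case/andP: p01.
apply: IH => //; first by rewrite -cY.
by move=> E f EU; rewrite inE => /andP[_ fY]; apply: hdel.
Qed.

End RandomSet.

Lemma bin_le_expn n j : ('C(n, j) <= n ^ j)%N.
Proof.
elim: j n => [|j IH] n; first by rewrite bin0.
apply: (@leq_trans (j.+1 * 'C(n, j.+1))%N); first by rewrite leq_pmull.
rewrite -mul_bin_diag expnS leq_mul2l (leq_trans (IH _)) ?orbT //.
by case: (posnP j) => [->//|j0]; rewrite leq_exp2r // leq_pred.
Qed.

Lemma sum_subset_card (R : pzRingType) (T : finType) (A : {set T}) (j : nat) :
  \sum_(S : {set T} | #|S| == j) (S \subset A)%:R = 'C(#|A|, j)%:R :> R.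
Proof.
rewrite -cards_draws -sum1_card natr_sum big_mkcond [RHS]big_mkcond /=.
by apply: eq_bigr => S _; rewrite inE andbC; case: (#|S| == j); case: (S \subset A).
Qed.

(** The binomial theorem over subsets: it turns an exponential moment into a sum over events
    [S \subset A], to which [expect_subset_le] applies. *)
Lemma sum_subset_exp (R : comPzRingType) (T : finType) (A : {set T}) (b : R) :
  \sum_(S : {set T}) (S \subset A)%:R * b ^+ #|S| = (1 + b) ^+ #|A|.
Proof.
have -> : (1 + b) ^+ #|A| = \prod_i ((if i \in A then b else 0) + 1).
  rewrite -prodr_const big_mkcond /=; apply: eq_bigr => i _.
  by case: ifP => _; rewrite ?add0r // addrC.
rewrite bigA_distr; apply: eq_bigr => S _; rewrite -big_mkcond /=.
case SA: (S \subset A).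
  rewrite mul1r -prodr_const; apply: eq_bigr => i iS.
  by rewrite (fintype.subsetP SA).
rewrite mul0r; have /subsetPn[i iS iA] := negbT SA.
by rewrite (bigD1 i) //= (negbTE iA) mul0r.
Qed.

(** Compare with 1 / (1 - x): the product (1 - x)(1 + x + 2x^2) equals 1 + x^2 (1 - 2x), at least 1
    on this range. *)
Lemma expR_le_quad (R : realType) (x : R) : 0 <= x <= 2^-1 -> expR x <= 1 + x + 2 * x ^+ 2.
Proof.
case/andP=> x0 x2.
have y0 : 0 < 1 - x by lra.
have : 1 - x <= (expR x)^-1 by rewrite -expRN; have := expR_ge1Dx (- x).
rewrite -[leLHS]invrK lef_pV2 ?posrE ?expR_gt0 ?invr_gt0 // => /le_trans; apply.
rewrite -[leLHS]mul1r ler_pdivrMr //.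
have : 0 <= x ^+ 2 * (1 - 2 * x) by rewrite mulr_ge0 ?sqr_ge0 //; lra.
by rewrite !expr2; nra.
Qed.

(** * Factorial moments of the discoveries and exponential moment of the score *)

Section RandomExploration.
Variables (R : realType) (T : finType) (L : nat) (p : R).
Hypothesis p01 : 0 <= p <= 1.
Variables (f0 : {set T}) (f0_pair : f0 \in pairs T).

Local Notation Ex := (expect (pairs T) p).
Local Notation run E t := (run L E f0 t).


Lemma card_cross (f S : {set T}) : [disjoint f & S] -> #|cross f S| = (#|f| * #|S|)%N.
Proof.
move=> /pred0P fS; rewrite /cross curry_imset2X card_in_imset ?cardsX //.
move=> [a x] [b y]; rewrite !finset.in_setX /= => /andP[af xS] /andP[bf yS] e.
have disj z : z \in f -> z \in S -> False by move=> zf zS; have := fS z; rewrite /= zf zS.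
have ab : a = b.
  have : a \in [set b; y] by rewrite -e !inE eqxx.
  by rewrite in_set2 => /orP[/eqP //|/eqP ay]; case: (disj a) => //; rewrite ay.
have : x \in [set b; y] by rewrite -e !inE eqxx orbT.
rewrite in_set2 => /orP[/eqP xb|/eqP ->]; last by rewrite ab.
by case: (disj x) => //; rewrite xb.
Qed.

Lemma cross_pairs (f S : {set T}) : [disjoint f & S] -> cross f S \subset pairs T.
Proof.
move=> /pred0P fS; apply/fintype.subsetP => e /imset2P[a x af xS ->].
apply/pairsP; exists a, x; split => //; apply: contraTneq xS => <-.
by apply/negP => aS; have := fS a; rewrite /= af aS.
Qed.

Lemma cross_subset (E : {set {set T}}) (f S : {set T}) :
  (cross f S \subset E) = (S \subset common_nbrs E f).
Proof.
apply/fintype.subsetP/fintype.subsetP => [H x xS|H e /imset2P[a x af xS ->]].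
  by rewrite inE; apply/forall_inP => a af; apply: H; apply: imset2_f.
by have := H _ xS; rewrite inE => /forall_inP; apply.
Qed.

(** Sum over the next pair [f] and the [j]-sets [S] of undiscovered vertices. Deleting a pair of
    [cross f S] is invisible to the run by [run_del], so requiring all 2j of them to be edges costs
    a factor [p ^+ (2 * j)]. *)
Lemma expect_binomial_le t j (Z : state T -> R) : (forall s, 0 <= Z s) ->
  Ex (fun E => let s := run E t in Z s *
      (if next s is Some f then 'C(#|common_nbrs E f :\: disc s|, j)%:R else 0))
  <= 'C(#|T|, j)%:R * p ^+ (2 * j) * Ex (fun E => Z (run E t)).
Proof.
move=> Z0; have [p0 p1] := andP p01.
pose G f (S : {set T}) E : R :=
  ((next (run E t) == Some f) && [disjoint S & disc (run E t)])%:R * Z (run E t).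
have G0 f S E : 0 <= G f S E by rewrite /G mulr_ge0.
have -> : Ex (fun E => let s := run E t in Z s *
      (if next s is Some f then 'C(#|common_nbrs E f :\: disc s|, j)%:R else 0)) =
    \sum_(f : {set T}) \sum_(S : {set T} | #|S| == j)
      Ex (fun E => (cross f S \subset E)%:R * G f S E).
  under eq_bigr do rewrite -expect_sum.
  rewrite -expect_sum; apply: eq_expect => E _ /=.
  case Hn: next => [f|]; last first.
    by rewrite mulr0 big1 // => f _; rewrite big1 // => S _; rewrite /G Hn /= mul0r mulr0.
  rewrite (bigD1 f) //= [X in _ + X]big1 ?addr0 => [|g gf]; last first.
    by rewrite big1 // => S _; rewrite /G Hn (inj_eq Some_inj) eq_sym (negbTE gf) /= mul0r mulr0.
  rewrite -sum_subset_card big_distrr /=; apply: eq_bigr => S _.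
  rewrite /G Hn eqxx /= cross_subset mulrA -natrM mulnb mulrC; congr (_%:R * _).
  by rewrite finset.subsetD.
apply: (@le_trans _ _ (\sum_(f : {set T}) \sum_(S : {set T} | #|S| == j)
      p ^+ (2 * j) * Ex (G f S))).
  apply: ler_sum => f _; apply: ler_sum => S /eqP Sj.
  have [/andP[f2 fS]|H] := boolP ((f \in pairs T) && [disjoint f & S]); last first.
    have G00 E : G f S E = 0.
      rewrite /G; case: eqP => [/nextP[fg _]|]; last by rewrite mul0r.
      have [fP fV] := run_gen f0_pair fg.
      case SV: [disjoint S & disc (run E t)]; last by rewrite mul0r.
      move: H; rewrite fP /= disjoint_sym => /negP; case.
      by apply: disjointWr SV.
    by rewrite /expect !big1 ?mulr0 // => E _; rewrite G00 ?mulr0.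
  have -> : (2 * j)%N = #|cross f S|.
    by rewrite card_cross // Sj; move: f2; rewrite inE => /eqP ->.
  apply: expect_subset_le => //; first exact: cross_pairs.
  move=> E e EU /imset2P[a x af xS ->] eE; rewrite /G.
  have [xV|xV] := boolP (x \in disc (run E t)).
    rewrite (_ : [disjoint S & _] = false) ?andbF ?mul0r //.
      by rewrite mulr_ge0.
    by apply/negbTE/pred0Pn; exists x; rewrite /= xS xV.
  by rewrite (run_del f0_pair _ xV) // !inE eqxx orbT.
have -> : 'C(#|T|, j)%:R = \sum_(S : {set T} | #|S| == j) 1 :> R.
  by rewrite -cardsT -sum_subset_card; apply: eq_bigr => S _; rewrite finset.subsetT.
rewrite exchange_big /= -mulrA big_distrl /=; apply: ler_sum => S _.
rewrite mul1r -big_distrr /= ler_wpM2l ?exprn_ge0 // -expect_sum.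
apply: expect_le => // E _; case Hn: (next (run E t)) => [f|]; last first.
  by rewrite big1 // => f _; rewrite /G Hn mul0r.
rewrite (bigD1 f) //= [X in _ + X]big1 ?addr0 => [|g gf]; last first.
  by rewrite /G Hn (inj_eq Some_inj) eq_sym (negbTE gf) /= mul0r.
by rewrite /G; apply: ler_piMl => //; case: (_ && _).
Qed.

(** The factor [ok] caps every counted step at [L] common neighbours, which keeps the exponent of a
    single step small. *)
Definition score_weight (th : R) (s : state T) : R := expR (th * (score s)%:R) * (ok s)%:R.

Lemma score_weight_ge0 th s : 0 <= score_weight th s.
Proof. by rewrite mulr_ge0 ?expR_ge0. Qed.

(** An increment y of the score is at most 2L^2 on [ok], so th * y <= d and [expR_le_quad]
    linearises the exponential at the price of a factor 1 + 2d. The mean of y then comes from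
    [expect_binomial_le] with j = 2 and j = 1. *)
Lemma expect_score_step t (th d : R) : 0 <= th -> d <= 2^-1 -> th * (2 * L ^ 2)%N%:R <= d ->
  Ex (fun E => score_weight th (run E t.+1)) <=
  (1 + th * (1 + 2 * d) * ((#|T|%:R * p ^+ 2) ^+ 2 / 2 + 2 * (#|T|%:R * p ^+ 2))) *
    Ex (fun E => score_weight th (run E t)).
Proof.
move=> th0 d2 thd; set c := th * (1 + 2 * d).
have d0 : 0 <= d by apply: le_trans thd; rewrite mulr_ge0.
have c0 : 0 <= c by rewrite mulr_ge0 //; lra.
pose B j (E : {set {set T}}) (s : state T) : R :=
  if next s is Some f then 'C(#|common_nbrs E f :\: disc s|, j)%:R else 0.
have B0 j E s : 0 <= B j E s by rewrite /B; case: next.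
pose Z E := score_weight th (run E t).
have Z0 E : 0 <= Z E by exact: score_weight_ge0.
apply: (@le_trans _ _ (Ex (fun E => Z E +
    (c * (Z E * B 2%N E (run E t)) + 2 * c * (Z E * B 1%N E (run E t)))))).
  apply: expect_le => // E _ /=; rewrite -/(run E t) /Z /B.
  rewrite /step; case Hn: next => [f|] /=; last by rewrite !mulr0 !addr0.
  rewrite /score_weight /= natrD mulrDr expRD.
  set k := #|_ :\: _|; case: ok; rewrite ?mulr0 ?mul0r ?mulr0 ?addr0 //=.
  case CL: (_ <= L)%N; rewrite ?mulr0 ?mulr1 /= ?mulr0.
    set e := expR _; have e0 : 0 <= e by exact: expR_ge0.
    have kL : (k <= L)%N by apply: leq_trans CL; apply: subset_leq_card; apply: finset.subsetDl.
    set y := ('C(k, 2) + 2 * k)%N.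
    have yL : th * y%:R <= d.
      apply: le_trans thd; rewrite ler_wpM2l // ler_nat /y.
      apply: (@leq_trans (2 * k ^ 2)%N); last by rewrite leq_mul2l leq_sqr.
      by rewrite bin2 -mulnn; case: (k) => // m; have := leq_half_double (m.+1 * m) (m.+1 * m); nia.
    have y0 : 0 <= th * y%:R by rewrite mulr_ge0.
    have : expR (th * y%:R) <= 1 + c * y%:R.
      apply: le_trans (expR_le_quad _) _; first by rewrite y0 (le_trans yL).
      by rewrite /c; have : (th * y%:R) * (d - th * y%:R) >= 0; [rewrite mulr_ge0 // subr_ge0|lra].
    rewrite /y natrD natrM bin1 => H; have := ler_wpM2l e0 H; lra.
  by rewrite !(addr_ge0, mulr_ge0, expR_ge0, ler0n, c0).
rewrite !(expectD, expectZ) [leRHS]mulrDl mul1r; apply: lerD => //.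
have H2 := expect_binomial_le t 2 (@score_weight_ge0 th).
have H1 := expect_binomial_le t 1 (@score_weight_ge0 th).
have ExZ : 0 <= Ex Z.
  by apply: sumr_ge0 => E _; rewrite mulr_ge0 ?weight_ge0.
rewrite -/(Z) in H1 H2; rewrite /= in H1 H2.
have C2 : 'C(#|T|, 2)%:R <= #|T|%:R ^+ 2 / 2 :> R.
  rewrite ler_pdivlMr // -natrM -natrX ler_nat bin2 muln2.
  have := odd_double_half (#|T| * #|T|.-1); have : (#|T| * #|T|.-1 <= #|T| ^ 2)%N.
    by rewrite -mulnn leq_mul2l leq_pred orbT.
  by move: (_ * _)%N (_ ^ 2)%N => a b; clear; lia.
have {}H2 := le_trans H2 (ler_wpM2r ExZ (ler_wpM2r (exprn_ge0 4 (proj1 (andP p01))) C2)).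
rewrite bin1 in H1.
have {}H1 := ler_wpM2l (mulr_ge0 (ler0n R 2) c0) H1.
have {}H2 := ler_wpM2l c0 H2.
apply: le_trans (lerD H2 H1) _; rewrite /Z.
by rewrite le_eqVlt; apply/orP; left; apply/eqP; rewrite /= !exprS !expr0; field.
Qed.

Lemma expect_score t (th d : R) : 0 <= th -> d <= 2^-1 -> th * (2 * L ^ 2)%N%:R <= d ->
  Ex (fun E => score_weight th (run E t)) <=
  (1 + th * (1 + 2 * d) * ((#|T|%:R * p ^+ 2) ^+ 2 / 2 + 2 * (#|T|%:R * p ^+ 2))) ^+ t.
Proof.
move=> th0 d2 thd; elim: t => [|t IH].
  rewrite expr0 -[leRHS](expect1 (pairs T) p); apply: expect_le => // E _.
  by rewrite /score_weight /= mulr0 expR0 mulr1.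
apply: le_trans (expect_score_step t th0 d2 thd) _; rewrite [leRHS]exprS ler_wpM2l //.
have d0 : 0 <= d by apply: le_trans thd; rewrite mulr_ge0.
have [p0 _] := andP p01.
by rewrite addr_ge0 // !mulr_ge0 // ?addr_ge0 // !mulr_ge0 // ?exprn_ge0 // mulr_ge0 // exprn_ge0.
Qed.

(** Markov's inequality for [score_weight]. *)
Lemma prob_score_le t m (th d : R) : 0 <= th -> d <= 2^-1 -> th * (2 * L ^ 2)%N%:R <= d ->
  Ex (fun E => (ok (run E t) && (m <= score (run E t))%N)%:R) <=
  expR (- (th * m%:R)) *
  (1 + th * (1 + 2 * d) * ((#|T|%:R * p ^+ 2) ^+ 2 / 2 + 2 * (#|T|%:R * p ^+ 2))) ^+ t.
Proof.
move=> th0 d2 thd.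
apply: le_trans (ler_wpM2l (expR_ge0 _) (expect_score t th0 d2 thd)).
rewrite -expectZ; apply: expect_le => // E _; rewrite /score_weight mulrA -expRD.
case: ok; rewrite ?mulr0 //= mulr1; case: leqP => /= [mk|_]; last exact: expR_ge0.
by rewrite -[leLHS]expR0 ler_expR addrC -mulrBr mulr_ge0 // subr_ge0 ler_nat //.
Qed.

End RandomExploration.

Lemma card_frontier (T : finType) (V f N : {set T}) :
  (#|frontier V f N| <= #|N| * (#|V| + #|N|))%N.
Proof.
apply: (@leq_trans (#|N| * #|V :|: N|)%N); last first.
  by rewrite leq_mul2l (leq_trans (leq_card_setU _ _)) ?orbT.
rewrite -cardsX; apply: leq_trans (leq_imset_card (fun u => [set u.1; u.2]) _).
apply: subset_leq_card; apply/fintype.subsetP => e; rewrite inE => /andP[/pairsP[x [y [_ ->]]]].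
case/and3P=> /fintype.subsetP sub /pred0Pn[z /andP[/= + zN]] _.
have xV := sub x (set21 _ _); have yV := sub y (set22 _ _).
rewrite in_set2 => /orP[] /eqP zE; apply/imsetP; rewrite zE in zN.
  by exists (x, y) => //; rewrite finset.in_setX /= zN yV.
by exists (y, x) => /=; [rewrite finset.in_setX /= zN xV|rewrite finset.setUC].
Qed.

(** * Extra edges and large codegrees *)

Section ExtraEdges.
Variables (R : realType) (T : finType) (L : nat) (p : R).
Hypothesis p01 : 0 <= p <= 1.

Local Notation Ex := (expect (pairs T) p).

Section FixedStart.
Variables (f0 : {set T}) (f0_pair : f0 \in pairs T).

Local Notation run E t := (run L E f0 t).

Definition extra_weight (b : R) (s : state T) : R := (1 + b) ^+ #|extra s| * (ok s)%:R.

Definition next_frontier (E : {set {set T}}) (s : state T) : {set {set T}} :=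
  if next s is Some f then frontier (disc s) f (common_nbrs E f :\: disc s) else finset.set0.

Lemma next_frontier_pairs E s : next_frontier E s \subset pairs T.
Proof.
rewrite /next_frontier; case: next => [f|]; last exact: finset.sub0set.
by apply/fintype.subsetP => e; rewrite inE => /andP[].
Qed.

Lemma card_next_frontier E t : ok (step L E (run E t)) ->
  (#|next_frontier E (run E t)| <= L * (2 + t * L + L))%N.
Proof.
move=> okS; have oks := ok_step okS; move: okS.
rewrite /next_frontier /step; case: next => [f|] /=; last by rewrite cards0.
case/andP => _ CL; apply: leq_trans (card_frontier _ _ _) _.
have NL : (#|common_nbrs E f :\: disc (run E t)| <= L)%N.
  by apply: leq_trans CL; apply: subset_leq_card; apply: finset.subsetDl.
by rewrite leq_mul // leq_add // (card_disc_run f0_pair).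
Qed.

(** A frontier pair has an undiscovered end, so the past is unchanged by [run_del]; it is no
    evidence for a common neighbour either, so the present step finds the same vertices by
    [common_nbrs_del]. *)
Lemma next_frontier_del E t e : e \in next_frontier E (run E t) ->
  [/\ run (E :\ e) t = run E t,
      next_frontier (E :\ e) (run E t) = next_frontier E (run E t) &
      ok (step L (E :\ e) (run E t)) = ok (step L E (run E t))].
Proof.
rewrite /next_frontier /step; case Hn: next => [f|] /=; last by rewrite inE.
have [fg _] := nextP Hn; have [_ fV] := run_gen f0_pair fg.
move=> eF; rewrite (common_nbrs_del fV eF); split => //.
move: eF; rewrite inE => /andP[_ /and3P[_ /pred0Pn[x /andP[/= xe xN]] _]].
by move: xN; rewrite finset.in_setD => /andP[xV _]; apply: run_del xV.
Qed.

(** With F the frontier, expand [(1 + b) ^+ #|E :&: F|] as a sum over subsets [Y], replace each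
    event [Y \subset E] by [p ^+ #|Y|], and resum to [(1 + b * p) ^+ #|F|]. *)
Lemma expect_extra_step t (b : R) : 0 <= b ->
  Ex (fun E => extra_weight b (run E t.+1)) <=
  (1 + b * p) ^+ (L * (2 + t * L + L)) * Ex (fun E => extra_weight b (run E t)).
Proof.
move=> b0; have [p0 p1] := andP p01.
have b1 : 0 <= 1 + b by rewrite addr_ge0.
(* Taking [ok] after the step bounds the size of the frontier, and deleting a frontier edge does not
   alter it. *)
pose W E : R := (1 + b) ^+ #|extra (run E t)| * (ok (step L E (run E t)))%:R.
have W0 E : 0 <= W E by rewrite mulr_ge0 ?exprn_ge0.
pose G (Y : {set {set T}}) E : R := b ^+ #|Y| * ((Y \subset next_frontier E (run E t))%:R * W E).
have G0 Y E : 0 <= G Y E by rewrite mulr_ge0 ?exprn_ge0 // mulr_ge0.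
apply: (@le_trans _ _ (\sum_(Y : {set {set T}}) Ex (fun E => (Y \subset E)%:R * G Y E))).
  rewrite -expect_sum; apply: expect_le => // E _.
  have -> : \sum_(Y : {set {set T}}) (Y \subset E)%:R * G Y E =
            (1 + b) ^+ #|E :&: next_frontier E (run E t)| * W E.
    rewrite -sum_subset_exp big_distrl /=; apply: eq_bigr => Y _.
    by rewrite finset.subsetI -mulnb natrM /G -!mulrA; congr (_ * _); rewrite mulrCA.
  rewrite /extra_weight /= -/(run E t) /W mulrA -exprD ler_wpM2r //.
  apply: ler_weXn2l; first by rewrite lerDl.
  rewrite addnC /next_frontier /step; case: next => [f|] /=; last by rewrite leq_addr.
  by rewrite (leq_trans (leq_card_setU _ _)).
apply: (@le_trans _ _ (\sum_(Y : {set {set T}}) p ^+ #|Y| * Ex (G Y))).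
  apply: ler_sum => Y _; have [YU|YU] := boolP (Y \subset pairs T); last first.
    have G00 E : G Y E = 0.
      rewrite /G (_ : (Y \subset _) = false) ?mul0r ?mulr0 //.
      by apply: contraNF YU => H; apply: fintype.subset_trans H (next_frontier_pairs _ _).
    by rewrite /expect !big1 ?mulr0 // => E _; rewrite G00 ?mulr0.
  apply: expect_subset_le => // E e EU eY eE; rewrite /G /W.
  case YF: (Y \subset next_frontier E _); last by rewrite mul0r mulr0 !mulr_ge0 ?exprn_ge0.
  have [-> -> ->] := next_frontier_del (fintype.subsetP YF _ eY).
  by rewrite YF.
have -> : \sum_(Y : {set {set T}}) p ^+ #|Y| * Ex (G Y) =
    Ex (fun E => (1 + b * p) ^+ #|next_frontier E (run E t)| * W E).
  under eq_bigr do rewrite -expectZ.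
  rewrite -expect_sum; apply: eq_expect => E _.
  rewrite -sum_subset_exp big_distrl /=; apply: eq_bigr => Y _.
  rewrite /G exprMn -!mulrA [LHS]mulrCA [RHS]mulrCA; congr (_ * _).
  exact: mulrCA.
rewrite -expectZ; apply: expect_le => // E _; rewrite /W /extra_weight.
have bp : 0 <= b * p by rewrite mulr_ge0.
case okS: ok; last by rewrite !mulr0 !mulr_ge0 ?exprn_ge0 ?addr_ge0.
rewrite (ok_step okS) mulr1 ler_wpM2r ?exprn_ge0 //.
by apply: ler_weXn2l; [rewrite lerDl|apply: card_next_frontier].
Qed.

Lemma expect_extra t n (b : R) : 0 <= b -> (t <= n)%N ->
  Ex (fun E => extra_weight b (run E t)) <= (1 + b * p) ^+ (t * (L * (2 + n * L + L))).
Proof.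
move=> b0; have [p0 p1] := andP p01.
have bp : 0 <= b * p by rewrite mulr_ge0.
elim: t => [|t IH] tn.
  rewrite mul0n expr0 -[leRHS](expect1 (pairs T) p); apply: expect_le => // E _.
  by rewrite /extra_weight /= cards0 expr0 mulr1.
apply: le_trans (expect_extra_step t b0) _; rewrite mulSn exprD.
apply: ler_pM; rewrite ?exprn_ge0 ?addr_ge0 //.
- by apply: sumr_ge0 => E _; rewrite mulr_ge0 ?weight_ge0 // mulr_ge0 // exprn_ge0 // addr_ge0.
- apply: ler_weXn2l; first by rewrite lerDl.
  by rewrite leq_mul2l leq_add2r leq_add2l leq_mul2r (ltnW tn) !orbT.
- exact/IH/ltnW.
Qed.

(** Markov's inequality: five extra edges make [extra_weight] at least [b ^+ 5]. *)
Lemma prob_extra_le t (b : R) : 0 < b ->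
  Ex (fun E => (ok (run E t) && (4 < #|extra (run E t)|)%N)%:R) <=
  b ^- 5 * (1 + b * p) ^+ (t * (L * (2 + t * L + L))).
Proof.
move=> b0; have bge0 := ltW b0.
apply: le_trans (ler_wpM2l _ (expect_extra bge0 (leqnn t))); last first.
  by rewrite invr_ge0 exprn_ge0.
rewrite -expectZ; apply: expect_le => // E _; rewrite /extra_weight.
have b50 : 0 <= b ^- 5 by rewrite invr_ge0 exprn_ge0.
have b1 : 0 <= (1 + b) by rewrite addr_ge0.
case: ok; rewrite ?mulr0 //= mulr1; case: ltnP => /= [x5|_]; last first.
  by rewrite mulr_ge0 // exprn_ge0.
rewrite mulrC ler_pdivlMr ?exprn_gt0 // mul1r.
apply: (@le_trans _ _ ((1 + b) ^+ 5)); first by rewrite lerXn2r ?nnegrE // lerDr.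
by apply: ler_weXn2l x5; rewrite lerDl.
Qed.

End FixedStart.

(** First moment over the (L+1)-sets of common neighbours, each of which forces 2(L+1) edges. *)
Lemma prob_codegree_le (f : {set T}) : f \in pairs T ->
  Ex (fun E => (L < #|common_nbrs E f|)%N%:R) <= (#|T|%:R * p ^+ 2) ^+ L.+1.
Proof.
move=> fP; have [p0 p1] := andP p01.
apply: (@le_trans _ _ (\sum_(S : {set T} | (#|S| == L.+1)) p ^+ (2 * L.+1))).
  apply: (@le_trans _ _ (\sum_(S : {set T} | #|S| == L.+1)
      Ex (fun E => (cross f S \subset E)%:R * [disjoint f & S]%:R))).
    rewrite -expect_sum; apply: expect_le => // E EU.
    have -> : \sum_(S : {set T} | #|S| == L.+1) (cross f S \subset E)%:R * [disjoint f & S]%:R =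
              'C(#|common_nbrs E f|, L.+1)%:R :> R.
      rewrite -sum_subset_card; apply: eq_bigr => S _; rewrite cross_subset.
      case SC: (S \subset _); rewrite ?mul0r // mul1r.
      suff -> : [disjoint f & S] by [].
      apply/pred0P => x /=; apply/negbTE/negP => /andP[xf xS].
      have := fintype.subsetP SC _ xS; rewrite inE => /forall_inP/(_ _ xf)/(fintype.subsetP EU).
      by rewrite inE cards2 eqxx.
    by case: ltnP => //= H; rewrite ler1n bin_gt0.
  apply: ler_sum => S /eqP SL; have [fS|fS] := boolP [disjoint f & S]; last first.
    by rewrite /expect big1 ?exprn_ge0 // => E _; rewrite !mulr0.
  have -> : (2 * L.+1)%N = #|cross f S|.
    by rewrite card_cross // SL; move: fP; rewrite inE => /eqP ->.
  have := expect_subset_le p01 (h := fun=> 1) (cross_pairs fS) (fun=> ler01) (fun _ _ _ _ _ => lexx _).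
  by rewrite expect1 mulr1.
rewrite sumr_const -[leLHS]mulr_natl exprMn -exprM ler_wpM2r ?exprn_ge0 // -natrX ler_nat.
apply: leq_trans (bin_le_expn _ _).
by rewrite -cardsT -cards_draws subset_leq_card //; apply/fintype.subsetP => S; rewrite !inE finset.subsetT.
Qed.

End ExtraEdges.

(** * Failure probability for fixed n *)

Lemma gnp_probE (R : realType) n (p : R) (A : pred {set {set 'I_n}}) :
  gnp_prob p A = expect (pairs 'I_n) p (fun E => (A E)%:R).
Proof.
rewrite /gnp_prob /expect big_mkcondr /=; apply: eq_bigr => E _; rewrite /weight.
by case: (A E); rewrite ?mulr1 ?mulr0.
Qed.

Lemma gnp_prob_le1 (R : realType) n (p : R) (A : pred {set {set 'I_n}}) :
  0 <= p <= 1 -> gnp_prob p A <= 1.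
Proof.
move=> p01; rewrite gnp_probE -[leRHS](expect1 (pairs 'I_n) p).
by apply: expect_le => // E _; case: (A E).
Qed.

(** If no pair fails, the codegree clause makes every run [ok], and any member of a component serves
    as a start whose run covers it. *)
Lemma large_support_witness (R : realType) (T : finType) L t (B : R) (E : {set {set T}}) :
  E \subset pairs T -> (2 + t * L)%N%:R <= B ->
  ~~ [forall C in square_components E, #|supp C|%:R <= B] ->
  [exists f in pairs T, [|| (ok (run L E f t) && (4 < #|extra (run L E f t)|)%N),
     (ok (run L E f t) && (t - (1 + 224 * L ^ 2) <= score (run L E f t))%N) |
     (L < #|common_nbrs E f|)%N]].
Proof.
move=> EP tB; apply: contraR => /exists_inPn H; apply/forall_inP => C CE.
have nbrs f : f \in pairs T -> (#|common_nbrs E f| <= L)%N.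
  by move=> fP; have := H f fP; rewrite !negb_or -leqNgt => /and3P[].
have /imsetP[f fN Cf] := CE.
have fC : f \in C by rewrite Cf inE fN connect0.
have fP : f \in pairs T by move: fN; rewrite inE => /andP[].
have okf := ok_run fP t nbrs.
have := H f fP; rewrite okf /= !negb_or -leqNgt -ltnNge => /and3P[x4 sc _].
apply: le_trans tB; rewrite ler_nat; apply: (supp_component_small EP fN) CE fC => //.
by clear - sc; lia.
Qed.

(** Union bound over all pairs rather than over nonedges, so that the range of starts is not
    random. *)
Lemma small_support_prob_ge (R : realType) n (p : R) L t (B b th d : R) :
  0 <= p <= 1 -> (2 + t * L)%N%:R <= B -> 0 < b ->
  0 <= th -> d <= 2^-1 -> th * (2 * L ^ 2)%N%:R <= d ->
  1 - n%:R ^+ 2 * (b ^- 5 * (1 + b * p) ^+ (t * (L * (2 + t * L + L))) +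
     expR (- (th * (t - (1 + 224 * L ^ 2))%N%:R)) *
       (1 + th * (1 + 2 * d) * ((n%:R * p ^+ 2) ^+ 2 / 2 + 2 * (n%:R * p ^+ 2))) ^+ t +
     (n%:R * p ^+ 2) ^+ L.+1)
  <= gnp_prob p (fun E : {set {set 'I_n}} =>
       [forall C in square_components E, #|supp C|%:R <= B]).
Proof.
move=> p01 tB b0 th0 d2 thd; have [p0 _] := andP p01.
rewrite gnp_probE lerBlDr.
set good := fun E : {set {set 'I_n}} => (_ : R).
set eps := (_ + _ + _).
pose F1 f (E : {set {set 'I_n}}) : R := (ok (run L E f t) && (4 < #|extra (run L E f t)|)%N)%:R.
pose F2 f (E : {set {set 'I_n}}) : R :=
  (ok (run L E f t) && (t - (1 + 224 * L ^ 2) <= score (run L E f t))%N)%:R.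
pose F3 f (E : {set {set 'I_n}}) : R := (L < #|common_nbrs E f|)%N%:R.
apply: (@le_trans _ _ (expect (pairs 'I_n) p
    (fun E => good E + \sum_(f in pairs 'I_n) (F1 f E + F2 f E + F3 f E)))).
  rewrite -[leLHS](expect1 (pairs 'I_n) p); apply: expect_le => // E EP.
  have F0 f : 0 <= F1 f E + F2 f E + F3 f E by rewrite !addr_ge0.
  rewrite /good; case: (boolP [forall _ in _, _]) => [_|]; first by rewrite lerDl sumr_ge0.
  move/(large_support_witness EP tB) => /exists_inP[f fP Hf].
  rewrite add0r (bigD1 f) //= ler_wpDr ?sumr_ge0 //.
  rewrite /F1 /F2 /F3; case/or3P: Hf => ->.
  - by rewrite -addrA lerDl addr_ge0.
  - by rewrite addrAC lerDr addr_ge0.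
  - by rewrite lerDr addr_ge0.
rewrite expectD lerD2l expect_sum.
have eps0 : 0 <= eps.
  have np0 : 0 <= n%:R * p ^+ 2 :> R by rewrite mulr_ge0 ?exprn_ge0.
  have d0 : 0 <= d by apply: le_trans thd; rewrite mulr_ge0.
  rewrite /eps !addr_ge0 ?mulr_ge0 ?invr_ge0 ?exprn_ge0 ?expR_ge0 ?(ltW b0) //.
    by rewrite addr_ge0 // mulr_ge0 // ltW.
  by rewrite !(addr_ge0, mulr_ge0, exprn_ge0, invr_ge0).
apply: (@le_trans _ _ (\sum_(f in pairs 'I_n) eps)).
  apply: ler_sum => f fP; rewrite !expectD /eps.
  apply: lerD; first apply: lerD.
  - exact: prob_extra_le.
  - by have := prob_score_le p01 fP t (t - (1 + 224 * L ^ 2)) th0 d2 thd; rewrite card_ord.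
  - by have := prob_codegree_le L p01 fP; rewrite card_ord.
rewrite sumr_const -[leLHS]mulr_natl ler_wpM2r // -natrX ler_nat.
have -> : #|pairs 'I_n| = 'C(n, 2).
  by have := card_draws 'I_n 2; rewrite card_ord.
exact: bin_le_expn.
Qed.

Lemma exprn_1D_le_expR (R : realType) (x : R) n : 0 <= 1 + x -> (1 + x) ^+ n <= expR (n%:R * x).
Proof. by move=> x0; rewrite expRM_natl lerXn2r ?nnegrE ?expR_ge0 ?expR_ge1Dx. Qed.

Lemma two_le_expR1 (R : realType) : 2 <= expR 1 :> R.
Proof. by have := expR_ge1Dx (1 : R); lra. Qed.

Lemma expn_le_exp2 k l : (0 < k)%N -> (l ^ k <= k ^ k * 2 ^ l)%N.
Proof.
move=> k0; have lk : (l <= k * 2 ^ (l %/ k))%N.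
  apply: (@leq_trans (k * (l %/ k).+1)%N); first by rewrite mulnC ltnW // ltn_ceil.
  by rewrite leq_mul2l ltn_expl ?orbT.
apply: leq_trans (_ : (k * 2 ^ (l %/ k)) ^ k <= _)%N; first by rewrite leq_exp2r.
by rewrite expnMn -expnM leq_mul2l leq_exp2l // leq_trunc_div orbT.
Qed.

(** * Numerical bounds for the three error terms *)

Section Bounds.
Variables (R : realType) (lam p d : R) (kap n l : nat).
Hypotheses (n0 : (0 < n)%N) (l0 : (0 < l)%N) (nl : (n <= 2 ^ l)%N).
Hypotheses (lam0 : 0 <= lam) (p0 : 0 <= p) (plam : p <= lam / Num.sqrt n%:R).
Hypotheses (lam_half : lam ^+ 2 <= 2^-1).

Let sn_gt0 : 0 < Num.sqrt n%:R :> R.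
Proof. by rewrite sqrtr_gt0 ltr0n. Qed.

Let sn_sqr : Num.sqrt n%:R ^+ 2 = n%:R :> R.
Proof. by rewrite sqr_sqrtr. Qed.

Lemma np2_le : n%:R * p ^+ 2 <= lam ^+ 2.
Proof.
have -> : lam ^+ 2 = n%:R * (lam / Num.sqrt n%:R) ^+ 2.
  by rewrite expr_div_n sn_sqr; field; rewrite gt_eqF // ltr0n.
by rewrite ler_wpM2l // lerXn2r ?nnegrE // (le_trans p0).
Qed.

(** The choice b = sqrt n / q makes b * p at most 1 / q, hence the power at most e, while [b ^- 5]
    equals q^5 n^(-5/2) and beats n^2. *)
Lemma extra_term_le q : (0 < q)%N ->
  n%:R ^+ 2 * ((Num.sqrt n%:R / q%:R) ^- 5 * (1 + Num.sqrt n%:R / q%:R * p) ^+ q) <=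
  expR 1 * q%:R ^+ 5 / Num.sqrt n%:R.
Proof.
move=> q0; set b := _ / q%:R; have qR : 0 < q%:R :> R by rewrite ltr0n.
have b0 : 0 < b by rewrite divr_gt0.
have lam1 : lam <= 1.
  by rewrite leNgt; apply/negP => H; have : 1 * 1 < lam * lam by [rewrite ltr_pM]; move: lam_half; rewrite expr2; lra.
have bp : b * p <= q%:R^-1.
  apply: (@le_trans _ _ (b * (lam / Num.sqrt n%:R))); first by rewrite ler_wpM2l // ltW.
  rewrite /b [leLHS](_ : _ = lam / q%:R); last by field; rewrite !gt_eqF.
  by rewrite ler_pdivrMr // mulVf // gt_eqF.
have bp0 : 0 <= b * p by rewrite mulr_ge0 // ltW.
have H : (1 + b * p) ^+ q <= expR 1.
  apply: le_trans (exprn_1D_le_expR _ _) _; first by rewrite addr_ge0.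
  by rewrite ler_expR mulrC -ler_pdivlMr // div1r.
have -> : expR 1 * q%:R ^+ 5 / Num.sqrt n%:R = n%:R ^+ 2 * (b ^- 5 * expR 1).
  have -> : n%:R ^+ 2 = Num.sqrt n%:R ^+ 4 :> R.
    by rewrite (exprM _ 2 2) sn_sqr.
  by rewrite /b; field; rewrite !gt_eqF.
by rewrite ler_wpM2l ?exprn_ge0 // ler_wpM2l // invr_ge0 exprn_ge0 // ltW.
Qed.

(** As n p^2 is at most 1/2, the power is at most 2^(-3l), and n <= 2^l turns this into n^(-3). *)
Lemma codegree_term_le : n%:R ^+ 2 * (n%:R * p ^+ 2) ^+ (3 * l).+1 <= n%:R^-1.
Proof.
have nR : 0 < n%:R :> R by rewrite ltr0n.
have x0 : 0 <= n%:R * p ^+ 2 by rewrite mulr_ge0 ?exprn_ge0.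
apply: (@le_trans _ _ (n%:R ^+ 2 * (n%:R ^- 3))); last first.
  by rewrite le_eqVlt; apply/orP; left; apply/eqP; field; rewrite gt_eqF.
rewrite ler_wpM2l ?exprn_ge0 //.
apply: (@le_trans _ _ ((2^-1) ^+ (3 * l))).
  apply: (@le_trans _ _ ((2^-1) ^+ (3 * l).+1)).
    by rewrite lerXn2r ?nnegrE // (le_trans np2_le).
  by rewrite exprS ler_piMl ?exprn_ge0 //; lra.
rewrite exprVn lef_pV2 ?posrE ?exprn_gt0 // mulnC exprM lerXn2r ?nnegrE ?exprn_ge0 //.
by rewrite -natrX ler_nat.
Qed.

(** Here th * L^2 = d / 2 and th * t = d * kap * l / 18. The exponents add up to at most 225 d / 2 -
    d^2 * kap * l / 9, hence to at most 113 - 3l, and n <= 2^l <= e^l. *)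
Lemma score_term_le : let L := (3 * l)%N in let t := (kap * l ^ 3)%N in
  let th := d / (2 * L ^ 2)%N%:R in
  0 < d -> d <= 4^-1 -> (1 + 2 * d) * (lam ^+ 4 / 2 + 2 * lam ^+ 2) <= 1 - 2 * d ->
  27 <= d ^+ 2 * kap%:R ->
  n%:R ^+ 2 * (expR (- (th * (t - (1 + 224 * L ^ 2))%N%:R)) *
     (1 + th * (1 + 2 * d) * ((n%:R * p ^+ 2) ^+ 2 / 2 + 2 * (n%:R * p ^+ 2))) ^+ t)
  <= expR 113 / n%:R.
Proof.
move=> L t th d0 d4 sub kapd.
have nR : 0 < n%:R :> R by rewrite ltr0n.
have lR : 1 <= l%:R :> R by rewrite ler1n.
have x0 : 0 <= n%:R * p ^+ 2 by rewrite mulr_ge0 ?exprn_ge0.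
set x := n%:R * p ^+ 2 in x0 *; have xlam : x <= lam ^+ 2 := np2_le.
have LR : L%:R = 3 * l%:R :> R by rewrite /L natrM.
have tR : t%:R = kap%:R * l%:R ^+ 3 :> R by rewrite /t natrM natrX.
have thE : th = d / (18 * l%:R ^+ 2).
  by rewrite /th natrM natrX LR; field; rewrite gt_eqF // (lt_le_trans ltr01).
have th0 : 0 <= th by rewrite /th divr_ge0 // ltW.
have mu : (1 + 2 * d) * (x ^+ 2 / 2 + 2 * x) <= 1 - 2 * d.
  apply: le_trans sub; rewrite ler_wpM2l //; first lra.
  have -> : lam ^+ 4 = (lam ^+ 2) ^+ 2 by rewrite -exprM.
  have : x ^+ 2 <= (lam ^+ 2) ^+ 2 by rewrite lerXn2r ?nnegrE ?exprn_ge0.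
  lra.
have mu0 : 0 <= (1 + 2 * d) * (x ^+ 2 / 2 + 2 * x).
  rewrite mulr_ge0 //; first lra.
  by rewrite addr_ge0 ?mulr_ge0 // ?exprn_ge0 // invr_ge0.
have H1 : (1 + th * (1 + 2 * d) * (x ^+ 2 / 2 + 2 * x)) ^+ t <= expR (t%:R * (th * (1 - 2 * d))).
  apply: le_trans (exprn_1D_le_expR _ _) _; first by rewrite -mulrA addr_ge0 // mulr_ge0.
  by rewrite ler_expR ler_wpM2l // -mulrA ler_wpM2l.
have H2 : t%:R - 225 * L%:R ^+ 2 <= (t - (1 + 224 * L ^ 2))%N%:R :> R.
  have : (t <= (t - (1 + 224 * L ^ 2)) + (225 * L ^ 2))%N.
    by have : (0 < L ^ 2)%N; [rewrite expn_gt0 muln_gt0 l0|move: (L ^ 2)%N (t) => a c; clear; lia].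
  by rewrite -(ler_nat R) natrD natrM natrX; lra.
apply: (@le_trans _ _ (n%:R ^+ 2 * expR (113 - l%:R * 3))).
  rewrite ler_wpM2l ?exprn_ge0 //.
  apply: (@le_trans _ _ (expR (- (th * (t - (1 + 224 * L ^ 2))%N%:R)) * expR (t%:R * (th * (1 - 2 * d))))).
    by rewrite ler_wpM2l ?expR_ge0.
  rewrite -expRD ler_expR.
  have := ler_wpM2l th0 H2; set m := _%:R.
  have e1 : th * t%:R = d * kap%:R * l%:R / 18.
    by rewrite thE tR; field; rewrite gt_eqF // (lt_le_trans ltr01).
  have e2 : th * L%:R ^+ 2 = d / 2.
    by rewrite thE LR; field; rewrite gt_eqF // (lt_le_trans ltr01).
  have -> : t%:R * (th * (1 - 2 * d)) = th * t%:R - 2 * d * (th * t%:R) by ring.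
  rewrite mulrBr [th * (225 * _)]mulrCA e2 e1.
  have : 27 * l%:R <= d ^+ 2 * kap%:R * l%:R by rewrite ler_wpM2r.
  rewrite [2 * d * _](_ : _ = d ^+ 2 * kap%:R * l%:R / 9); last by field.
  lra.
rewrite expRB expRM_natr mulrCA ler_wpM2l ?expR_ge0 //.
rewrite ler_pdivrMr ?exprn_gt0 ?expR_gt0 // mulrC ler_pdivlMr // -exprSr.
rewrite lerXn2r ?nnegrE ?expR_ge0 //.
rewrite -[l%:R]mulr1 expRM_natl.
apply: (@le_trans _ _ (2 ^+ l)); first by rewrite -natrX ler_nat.
by rewrite lerXn2r ?nnegrE ?expR_ge0 ?two_le_expR1.
Qed.

End Bounds.

(** * Asymptotics *)

(** The successor gives [n < 2 ^ log2 n] and keeps the value positive. *)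
Definition log2 n := (trunc_log 2 n).+1.

Lemma ltn_log2 n : (n < 2 ^ log2 n)%N.
Proof. exact: trunc_log_ltn. Qed.

Lemma exp_log2_le n : (0 < n)%N -> (2 ^ log2 n <= 2 * n)%N.
Proof. by move=> n0; rewrite expnS leq_mul2l trunc_logP. Qed.

Lemma error_rate (R : realType) (kap : nat) : (0 < kap)%N ->
  exists2 c : R, 0 <= c & forall n,
    let l := log2 n in let L := (3 * l)%N in let t := (kap * l ^ 3)%N in (0 < n)%N ->
    expR 1 * (t * (L * (2 + t * L + L)))%N%:R ^+ 5 / Num.sqrt n%:R + expR 113 / n%:R + n%:R^-1
      <= c / l%:R.
Proof.
move=> k0.
(* 82 = 2 (5 * 8 + 1): the fifth power of a quantity of order l^8, times l, is compared with the
   square root of n. *)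
have [c Hc] : exists c, forall l, (l ^ 82 <= c * 2 ^ l)%N.
  by eexists => l; apply: expn_le_exp2.
exists (expR 1 * (24 * kap ^ 2)%N%:R ^+ 5 * Num.sqrt (c * 2)%N%:R + expR 113 + 1).
  by rewrite !addr_ge0 ?expR_ge0 // !mulr_ge0 ?expR_ge0 ?exprn_ge0 ?sqrtr_ge0.
move=> n l L t n0.
have l0 : (0 < l)%N by [].
have nR : 0 < n%:R :> R by rewrite ltr0n.
have lR : 0 < l%:R :> R by rewrite ltr0n.
have sn0 : 0 < Num.sqrt n%:R :> R by rewrite sqrtr_gt0.
have ln : l%:R <= n%:R :> R.
  by rewrite ler_nat; apply: leq_trans (trunc_logP (isT : (1 < 2)%N) n0); rewrite ltn_expl.
have inv : n%:R^-1 <= l%:R^-1 :> R by rewrite lef_pV2 ?posrE.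
have Qle : (t * (L * (2 + t * L + L)) <= 24 * kap ^ 2 * l ^ 8)%N.
  have -> : (24 * kap ^ 2 * l ^ 8 = t * (L * (8 * kap * l ^ 4)))%N.
    by rewrite /t /L; ring.
  rewrite leq_mul2l leq_mul2l; apply/orP; right; apply/orP; right.
  have -> : (t * L = 3 * kap * l ^ 4)%N by rewrite /t /L; ring.
  have l4 : (l <= l ^ 4)%N by rewrite -{1}[l]expn1 leq_pexp2l.
  have kl4 : (l ^ 4 <= kap * l ^ 4)%N by rewrite leq_pmull.
  have arith u w : (0 < w -> w <= u -> 2 + 3 * u + 3 * w <= 8 * u)%N by clear; lia.
  by rewrite -!mulnA; apply: arith => //; apply: leq_trans l4 kl4.
have cross_mul (a x y s r m : R) : 0 <= a -> 0 < r -> 0 < m -> x * m <= y * (s * r) ->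
    a * x / r <= a * y * s / m.
  move=> a0 r0 m0 H.
  by rewrite ler_pdivrMr // mulrAC ler_pdivlMr // -!mulrA ler_wpM2l.
rewrite !mulrDl mul1r; apply: lerD => //; apply: lerD; last by rewrite ler_wpM2l ?expR_ge0.
apply: cross_mul => //.
apply: (@le_trans _ _ (((24 * kap ^ 2)%N%:R * l%:R ^+ 8) ^+ 5 * l%:R)).
  rewrite ler_wpM2r // lerXn2r ?nnegrE ?mulr_ge0 ?exprn_ge0 //.
  by rewrite -natrX -natrM ler_nat.
rewrite exprMn -mulrA ler_wpM2l ?exprn_ge0 // -exprM -exprSr -sqrtrM //.
rewrite -[leLHS]ger0_norm ?exprn_ge0 // -sqrtr_sqr ler_wsqrtr // -exprM -natrX -natrM ler_nat.
by rewrite (leq_trans (Hc l)) // -mulnA leq_mul2l exp_log2_le ?orbT.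
Qed.

(** The left side is of order [log2 n ^ 4]. Once [ln n] is at least 1, it absorbs the additive
    constants and its exponent may be raised from 4 to [q]. *)
Lemma polylog_bound (R : realType) (kap q : nat) : (4 <= q)%N ->
  exists K : R, \forall n \near \oo%classic,
    (2 + kap * log2 n ^ 3 * (3 * log2 n))%N%:R <= K * ln n%:R ^+ q.
Proof.
move=> q4; pose c : R := 1 + (ln 2)^-1.
have ln2 : 0 < ln 2 :> R by rewrite ln_gt0 // ltr1n.
exists ((2 + 3 * kap)%N%:R * c ^+ 4).
near=> n.
have n0 : (0 < n)%N by near: n; exact: nbhs_infty_gt.
have nR : 0 < n%:R :> R by rewrite ltr0n.
have ln1 : 1 <= ln n%:R :> R.
  rewrite -[leLHS]expRK ler_ln ?posrE ?expR_gt0 //.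
  by near: n; exact: nbhs_infty_ger.
set l := log2 n.
have lc : l%:R <= c * ln n%:R.
  rewrite /l /log2 -add1n natrD mulrDl mul1r lerD // mulrC ler_pdivlMr //.
  rewrite mulr_natl -lnXn // ler_ln ?posrE ?exprn_gt0 // -natrX ler_nat.
  exact: trunc_logP.
apply: (@le_trans _ _ ((2 + 3 * kap)%N%:R * l%:R ^+ 4)).
  rewrite -natrX -natrM ler_nat mulnDl leq_add //; first by rewrite leq_pmulr // expn_gt0.
  by apply: eq_leq; ring.
rewrite -mulrA ler_wpM2l //.
apply: (@le_trans _ _ ((c * ln n%:R) ^+ 4)).
  by rewrite lerXn2r ?nnegrE // (le_trans _ lc).
rewrite exprMn ler_wpM2l ?exprn_ge0 ?ler_weXn2l //.
by rewrite addr_ge0 // invr_ge0 ltW.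
Unshelve. all: by end_near. Qed.

(** With x = lam^2 the assumption gives (x + 2)^2 < 6, that is x^2 / 2 + 2x < 1; and sqrt 6 < 5/2
    gives x <= 1/2. *)
Lemma subcritical (R : realType) (lam : R) : 0 <= lam -> lam < Num.sqrt (Num.sqrt 6 - 2) ->
  lam ^+ 2 <= 2^-1 /\ lam ^+ 4 / 2 + 2 * lam ^+ 2 < 1.
Proof.
move=> lam0 H; set s := Num.sqrt 6 : R in H.
have s0 : 0 <= s by exact: sqrtr_ge0.
have s2 : s ^+ 2 = 6 by rewrite sqr_sqrtr.
have s_lt : s < 5 / 2.
  rewrite ltNge; apply/negP => h; have : (5 / 2) ^+ 2 <= s ^+ 2 by rewrite lerXn2r ?nnegrE //; lra.
  by rewrite s2 expr2; lra.
have x_lt : lam ^+ 2 < s - 2.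
  have s_ge : 0 <= s - 2.
    rewrite subr_ge0 leNgt; apply/negP => h.
    have : s ^+ 2 < 2 ^+ 2 by rewrite ltrXn2r.
    by rewrite s2 expr2; lra.
  by rewrite -[ltRHS]sqr_sqrtr // ltrXn2r.
split; first lra.
rewrite (exprM _ 2 2); have x0 : 0 <= lam ^+ 2 by rewrite exprn_ge0.
have : (lam ^+ 2 + 2) ^+ 2 < s ^+ 2 by rewrite ltrXn2r //; lra.
by rewrite s2 sqrrD; lra.
Qed.

Lemma square_components_polylog (R : realType) (lam : R) (p : nat -> R) (q : nat) :
  (4 <= q)%N -> lam < Num.sqrt (Num.sqrt 6 - 2) -> (forall n, 0 <= p n <= 1) ->
  (forall n : nat, (0 < n)%N -> p n <= lam / Num.sqrt n%:R) ->
  exists K : R,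
    ((fun n : nat => gnp_prob (p n) (fun E : {set {set 'I_n}} =>
        [forall C in square_components E,
           #|supp C|%:R <= K * ln n%:R ^+ q]))
      @ \oo --> (1 : R))%classic.
Proof.
move=> q4 hlam hp01 hp.
(* The bound at n = 1 forces [lam] to be nonnegative. *)
have lam0 : 0 <= lam.
  have := hp 1%N isT; rewrite sqrtr1 divr1; apply: le_trans.
  by case/andP: (hp01 1%N).
have [lam2 sub] := subcritical lam0 hlam.
set a := _ + _ in sub; have a0 : 0 <= a by rewrite addr_ge0 ?divr_ge0 ?mulr_ge0 ?exprn_ge0.
(* With this [d], the inequality [dsub] below amounts to (1 - a)^2 >= 0. *)
pose d := (1 - a) / 4.
have d0 : 0 < d by rewrite divr_gt0 ?subr_gt0.
have d4 : d <= 4^-1 by rewrite /d; lra.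
have dsub : (1 + 2 * d) * a <= 1 - 2 * d.
  by have : 0 <= (1 - a) * (1 - a); [rewrite mulr_ge0 // subr_ge0 ltW|rewrite /d; lra].
pose kap := (Num.bound (27 / d ^+ 2)).+1.
have kapd : 27 <= d ^+ 2 * kap%:R.
  rewrite mulrC -ler_pdivrMr ?exprn_gt0 //.
  have /archi_boundP/ltW H : 0 <= 27 / d ^+ 2 by rewrite divr_ge0 // exprn_ge0 // ltW.
  by apply: le_trans H _; rewrite ler_nat.
have [K HK] := polylog_bound R kap q4; exists K.
have [c c0 Hc] := error_rate R (ltn0Sn _ : (0 < kap)%N).
apply/cvgrPdist_le => /= e e0; near=> n.
have n0 : (0 < n)%N by near: n; exact: nbhs_infty_gt.
have tB : (2 + kap * log2 n ^ 3 * (3 * log2 n))%N%:R <= K * ln n%:R ^+ q.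
  by near: n; exact: HK.
(* Since [n < 2 ^ log2 n], this forces [log2 n] above c / e, which makes the final error [c / l] at
   most [e]. *)
have n_large : (2 ^ Num.bound (c / e) <= n)%N by near: n; exact: nbhs_infty_ge.
have pn := hp01 n.
rewrite ger0_norm ?subr_ge0 ?gnp_prob_le1 //.
set l := log2 n; have l0 : (0 < l)%N by [].
have lR : 0 < l%:R :> R by rewrite ltr0n.
set L := (3 * l)%N; set t := (kap * l ^ 3)%N.
pose Q := (t * (L * (2 + t * L + L)))%N.
have Q0 : (0 < Q)%N by rewrite /Q muln_gt0 muln_gt0 addn_gt0 addn_gt0 /t /L muln_gt0 expn_gt0.
have b0 : 0 < Num.sqrt n%:R / Q%:R :> R by rewrite divr_gt0 ?sqrtr_gt0 ?ltr0n.
pose th := d / (2 * L ^ 2)%N%:R.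
have th0 : 0 <= th by rewrite divr_ge0 // ltW.
have thL : th * (2 * L ^ 2)%N%:R <= d.
  by rewrite /th divfK // pnatr_eq0 -lt0n muln_gt0 expn_gt0 /L muln_gt0 l0.
have d2 : d <= 2^-1 by lra.
have := small_support_prob_ge n pn tB b0 th0 d2 thL; rewrite -/Q => H.
rewrite lerBlDl -lerBlDr in H; apply: le_trans H _.
have [pn0 _] := andP pn.
have nl : (n <= 2 ^ l)%N by exact/ltnW/ltn_log2.
apply: (@le_trans _ _ (c / l%:R)).
  apply: le_trans (Hc n n0); rewrite mulrDr [X in X + _]mulrDr; apply: lerD; first apply: lerD.
  - by apply: (extra_term_le (lam := lam)) => //; apply: hp.
  - by apply: (score_term_le (lam := lam)) => //; apply: hp.
  - by apply: (codegree_term_le (lam := lam)) => //; apply: hp.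
rewrite ler_pdivrMr // mulrC -ler_pdivrMr //.
apply: le_trans (ltW (archi_boundP _)) _; first by rewrite divr_ge0 // ltW.
rewrite ler_nat ltnW // -(@ltn_exp2l 2) //; exact: leq_ltn_trans (ltn_log2 n).
Unshelve. all: by end_near. Qed.

Local Open Scope classical_set_scope.
Local Open Scope ring_scope.

Theorem theorem1p4 (R : realType) (lam : R) (p : nat -> R)
  (hlam : lam < Num.sqrt (Num.sqrt 6 - 2))
  (hp01 : forall n : nat, 0 <= p n <= 1)
  (hp : forall n : nat, (0 < n)%N -> p n <= lam / Num.sqrt n%:R) :
  exists K : R,
    (fun n : nat => gnp_prob (p n) (fun E : {set {set 'I_n}} =>
        [forall C in square_components E,
           #|supp C|%:R <= K * ln n%:R ^+ (2 ^ 32)%N]))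
      @ \oo --> (1 : R).
Proof.
apply: square_components_polylog hlam hp01 hp.
by rewrite -[4%N]/(2 ^ 2)%N leq_exp2l.
Qed.
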